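(* Cuntz's $C^*$-algebra $\mathcal Q_{\mathbb N}$ is the boundary quotient $C(\partial\Omega)\rtimes(\mathbb Q\rtimes\mathbb Q_+^* )$ of the Toeplitz algebra $\mathcal T(\mathbb N\rtimes\mathbb N^\times)$; that is, $\mathcal Q_{\mathbb N}$ is canonically isomorphic to $C(\partial\Omega)\rtimes(\mathbb Q\rtimes\mathbb Q_+^* )$, the generators $s$ and $u_a$ of $\mathcal Q_{\mathbb N}$ corresponding to the images of the Toeplitz isometries $w_{(1,1)}$ and $w_{(0,a)}$.
   Context: $\mathbb N=\{0,1,2,\dots\}$; $\mathbb N^\times$ is the multiplicative semigroup of positive integers; $G=\mathbb Q\rtimes\mathbb Q_+^*$ has product $(r,x)(s,y)=(r+xs,xy)$, $P=\mathbb N\rtimes\mathbb N^\times\subset G$, and $x\le y\iff x^{-1}y\in P$. $(G,P)$ is quasi-lattice ordered: elements with a common upper bound have a least upper bound $x\vee y$; write $x\vee y=\infty$ if there is no common upper bound. $\mathcal Q_{\mathbb N}$ is the universal $C^*$-algebra generated by a unitary $s$ and isometries $\{u_a:a\in\mathbb N^\times\}$ satisfying $u_as=s^au_a$, $u_au_b=u_{ab}$, and $\sum_{k=0}^{a-1}s^ku_au_a^*s^{*k}=1$ for all $a,b\in\mathbb N^\times$. $\mathcal T(P)$ is the $C^*$-algebra generated by the isometries $w_ye_x=e_{yx}$ on $\ell^2(P)$; $w$ is universal for Nica-covariant isometric representations of $P$, i.e. representations $W$ by isometries with $W_xW_x^*W_yW_y^*=W_{x\vee y}W_{x\vee y}^*$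 if $x\vee y<\infty$ and $=0$ if $x\vee y=\infty$. The Nica spectrum $\Omega$ is the set of nonempty hereditary (downward closed in $P$) directed subsets of $P$, topologised as a subset of $\{0,1\}^P$. The boundary $\partial\Omega$ is the closure in $\Omega$ of the set of maximal elements of $\Omega$ under inclusion. $G$ acts partially on $\Omega$: for $\omega\in\Omega$ let $\bar\omega=\{g\in G:g\le x\text{ for some }x\in\omega\}$; $\theta_g$ has domain $\{\omega:g^{-1}\in\bar\omega\}$ and $\theta_g(\omega)=(g\bar\omega)\cap P$. For $x\in P$, $\theta_x$ is defined on all of $\Omega$ and $\theta_x(\omega)$ is the hereditary closure of $x\omega$ in $P$. The set $\partial\Omega$ is invariant. $C(\Omega)\rtimes G$ and $C(\partial\Omega)\rtimes G$ denote the associated partial crossed products. It is known (Exel–Laca–Quigg) that $\mathcal T(P)\cong C(\Omega)\rtimes G$ canonically, with $w_x$ corresponding to $1_{\theta_x(\Omega)}\delta_x$, and the boundary quotient of $\mathcal T(P)$ is by definition $C(\partial\Omega)\rtimes G$, the quotient map being induced by restriction of functions to $\partial\Omega$. It is also known that $C(\partial\Omega)\rtimes G$ is isomorphic to the universal $C^*$-algebra generated by a Nica-covariant isometric representation $W$ of $P$ subject to the extra relations $\prod_{x\in F}(1-W_xW_x^* )=0$ for all finite $F\subset P$ such that for every $y\in P$ there exists $x\in F$ with $x\vee y<\infty$. *)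

(* Defs.v *)
From HB Require Import structures.
From mathcomp Require Import all_boot all_order all_algebra complex.
From mathcomp Require Import all_classical all_reals all_analysis.

Set Implicit Arguments.
Unset Strict Implicit.
Unset Printing Implicit Defensive.

Import Order.TTheory GRing.Theory Num.Theory numFieldNormedType.Exports.
Local Open Scope classical_set_scope.
Local Open Scope ring_scope.

(* Unital complex C*-algebras. The norm is a field of this mixin because
   algType and normedModType have no join, and none can be declared once
   numDomainType exists. *)
HB.mixin Record isCStar (R : realType) A of GRing.Algebra R[i] A := {
  star : A -> A;
  starK : involutive star;
  starD : {morph star : x y / x + y};
  starZ : forall (a : R[i]) x, star (a *: x) = a^* *: star x;
  starM : forall x y, star (x * y) = star y * star x;
  cnorm : A -> R;
  cnorm0_eq0 : forall x, cnorm x = 0 -> x = 0;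
  ler_cnormD : forall x y, cnorm (x + y) <= cnorm x + cnorm y;
  cnormZ : forall (a : R[i]) x, cnorm (a *: x) = complex.Re `|a| * cnorm x;
  ler_cnormM : forall x y, cnorm (x * y) <= cnorm x * cnorm y;
  cnorm_star_mul : forall x, cnorm (star x * x) = cnorm x ^+ 2;
  cnorm_complete : forall x_ : nat -> A,
    (forall e : R, 0 < e -> exists N, forall m n, (N <= m)%N -> (N <= n)%N ->
       cnorm (x_ m - x_ n) < e) ->
    exists x, (fun n => cnorm (x_ n - x) : R) @ \oo --> (0 : R)
}.

#[short(type="cstarType")]
HB.structure Definition CStar (R : realType) :=
  {A of isCStar R A & GRing.Algebra R[i] A}.

Section CStarTheory.
Variable R : realType.
Implicit Types A B : cstarType R.

Definition star_hom A B (phi : A -> B) : Prop :=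
  [/\ linear phi, phi 1 = 1, {morph phi : x y / x * y} &
      {morph phi : x / star x}].

Definition star_iso A B (phi : A -> B) : Prop := star_hom phi /\ bijective phi.

Definition cstar_subalgebra A (S : set A) : Prop :=
  [/\ S 1,
      forall (a : R[i]) x y, S x -> S y -> S (a *: x + y),
      forall x y, S x -> S y -> S (x * y),
      forall x, S x -> S (star x) &
      forall x, (forall e : R, 0 < e -> exists2 y, S y & cnorm (x - y) < e) ->
        S x].

Definition cstar_generated A (S : set A) : Prop :=
  forall S' : set A, S `<=` S' -> cstar_subalgebra S' -> S' = [set: A].

End CStarTheory.

Definition posrat := {x : rat | 0 < x}.
Definition posnat := {a : nat | (0 < a)%N}.

Definition posrat1 : posrat := exist _ 1 ltr01.
Definition posratM (x y : posrat) : posrat :=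
  exist (fun x : rat => 0 < x) (sval x * sval y) (mulr_gt0 (svalP x) (svalP y)).
Fact posratV_subproof (x : posrat) : 0 < (sval x)^-1.
Proof. by rewrite invr_gt0; exact: svalP x. Qed.
Definition posratV (x : posrat) : posrat :=
  exist (fun x : rat => 0 < x) _ (posratV_subproof x).

Definition posnat1 : posnat := exist _ 1%N isT.
Fact posnatM_subproof (a b : posnat) : (0 < sval a * sval b)%N.
Proof. by rewrite muln_gt0 (svalP a) (svalP b). Qed.
Definition posnatM (a b : posnat) : posnat :=
  exist (fun a : nat => 0 < a)%N _ (posnatM_subproof a b).

(* The group Q ><| Q_+^*. *)
Definition affQ : Type := (rat * posrat)%type.
HB.instance Definition _ := Choice.on affQ.

Section AffQGroup.

Definition affQ1 : affQ := (0, posrat1).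
Definition affQM (g h : affQ) : affQ :=
  (g.1 + sval g.2 * h.1, posratM g.2 h.2).
(* (r, x)^-1 = (- x^-1 r, x^-1) *)
Definition affQV (g : affQ) : affQ :=
  (- ((sval g.2)^-1 * g.1), posratV g.2).

Let affQ_eq (g h : affQ) : g.1 = h.1 -> sval g.2 = sval h.2 -> g = h.
Proof.
by case: g h => [r x] [s y] /= -> xy; congr (_, _); apply: val_inj.
Qed.

Fact affQMA : associative affQM.
Proof. by move=> g h k; apply: affQ_eq; rewrite /= ?mulrDr !mulrA ?addrA. Qed.
Fact affQM1g : left_id affQ1 affQM.
Proof. by move=> g; apply: affQ_eq; rewrite /= ?add0r mul1r. Qed.
Fact affQMg1 : right_id affQ1 affQM.
Proof. by move=> g; apply: affQ_eq; rewrite /= ?mulr0 ?addr0 ?mulr1. Qed.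
Fact affQMVg : left_inverse affQ1 affQV affQM.
Proof.
move=> g; apply: affQ_eq => /=; first by rewrite addNr.
by rewrite mulVf // gt_eqF //; exact: svalP g.2.
Qed.
Fact affQMgV : right_inverse affQ1 affQV affQM.
Proof.
have g0 (g : affQ) : sval g.2 != 0 by rewrite gt_eqF //; exact: svalP g.2.
move=> g; apply: affQ_eq => /=; last by rewrite mulfV.
by rewrite mulrN mulrA mulfV // mul1r subrr.
Qed.

HB.instance Definition _ :=
  isGroup.Build affQ affQMA affQM1g affQMg1 affQMVg affQMgV.

End AffQGroup.

(* The semigroup N ><| N^x, with its embedding into Q ><| Q_+^*. *)
Definition affN : Type := (nat * posnat)%type.
HB.instance Definition _ := Choice.on affN.

Definition affNM (p q : affN) : affN :=
  ((p.1 + sval p.2 * q.1)%N, posnatM p.2 q.2).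

Fact affN_emb_subproof (a : posnat) : 0 < (sval a)%:R :> rat.
Proof. by rewrite ltr0n; exact: svalP a. Qed.
Definition affN_emb (p : affN) : affQ :=
  (p.1%:R, exist (fun x : rat => 0 < x) _ (affN_emb_subproof p.2)).

Lemma affN_embM p q : affN_emb (affNM p q) = (affN_emb p * affN_emb q)%g.
Proof.
congr (_, _); first by rewrite /= natrD natrM.
by apply: val_inj; rewrite /= natrM.
Qed.

Definition affQ_le (g h : affQ) : Prop :=
  exists p : affN, (g^-1 * h)%g = affN_emb p.

Definition cubeP := prod_topology (fun _ : affN => bool).

Definition hereditary (w : cubeP) : Prop :=
  forall x y : affN, affQ_le (affN_emb x) (affN_emb y) -> w y -> w x.

Definition directed (w : cubeP) : Prop :=
  forall x y : affN, w x -> w y -> exists z : affN,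
    [/\ w z, affQ_le (affN_emb x) (affN_emb z) &
        affQ_le (affN_emb y) (affN_emb z)].

Definition nica_spectrum : set cubeP :=
  [set w : cubeP | [/\ exists x, w x, hereditary w & directed w]].

Definition maximal_spectrum : set cubeP :=
  [set w : cubeP | nica_spectrum w /\
     forall v, nica_spectrum v -> (forall x, w x -> v x) -> v = w].

Definition nica_boundary : set cubeP :=
  closure maximal_spectrum `&` nica_spectrum.

Definition hull (w : cubeP) : set affQ :=
  [set g | exists2 x, w x & affQ_le g (affN_emb x)].

Definition theta_dom (g : affQ) : set cubeP := [set w : cubeP | hull w g^-1%g].

Definition theta (g : affQ) (w : cubeP) : cubeP :=
  fun p => `[< exists2 h, hull w h & affN_emb p = (g * h)%g >].

Section PartialCrossedProduct.
Variables (R : realType) (G : groupType) (T : topologicalType).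
(* A partial action of G on X : the bijection [act g] goes from
   [X `&` dom g] onto [X `&` dom g^-1]; values outside X are irrelevant. *)
Variables (X : set T) (dom : G -> set T) (act : G -> T -> T).

(* The ideal D_g = C_0(X `&` dom g^-1) of C(X), for X compact. *)
Definition pcp_ideal (g : G) : set (T -> R[i]) :=
  [set f | {within X, continuous (f : T -> R[i]^o)} /\
     forall x, X x -> ~ dom g^-1%g x -> f x = 0].

(* The isomorphism D_(g^-1) -> D_g dual to [act g]. *)
Definition pcp_shift (g : G) (f : T -> R[i]) : T -> R[i] :=
  fun x => if x \in dom g^-1%g then f (act g^-1%g x) else 0.

(* [d g f] stands for f delta_g; the fields say that d is a unital
   *-homomorphism on the algebra of finite formal sums of the f delta_g. *)
Record pcp_rep (B : cstarType R) (d : G -> (T -> R[i]) -> B) : Prop := {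
  pcp_ext : forall g f h, pcp_ideal g f -> pcp_ideal g h ->
    (forall x, X x -> f x = h x) -> d g f = d g h;
  pcp_linear : forall g (a : R[i]) f h, pcp_ideal g f -> pcp_ideal g h ->
    d g (fun x => a * f x + h x) = a *: d g f + d g h;
  pcp_mul : forall g k f h, pcp_ideal g f -> pcp_ideal k h ->
    d g f * d k h =
    d (g * k)%g (pcp_shift g (fun x => pcp_shift g^-1%g f x * h x));
  pcp_star : forall g f, pcp_ideal g f ->
    star (d g f) = d g^-1%g (pcp_shift g^-1%g (fun x => (f x)^*));
  pcp_one : d 1%g (fun=> 1) = 1
}.

(* The enveloping C*-algebra of that algebra, i.e. C(X) ><| G. *)
Definition is_partial_crossed_product
    (B : cstarType R) (d : G -> (T -> R[i]) -> B) : Prop :=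
  [/\ pcp_rep d,
      cstar_generated [set b | exists g f, pcp_ideal g f /\ b = d g f] &
      forall (B' : cstarType R) (d' : G -> (T -> R[i]) -> B'), pcp_rep d' ->
        exists! psi : B -> B', star_hom psi /\
          forall g f, pcp_ideal g f -> psi (d g f) = d' g f].

End PartialCrossedProduct.

Section Toeplitz.
Variable R : realType.

Definition l2norm2 (xi : affN -> R[i]) : \bar R :=
  \esum_(x in [set: affN]) (complex.Re (`|xi x| ^+ 2))%:E.

Definition in_l2 (xi : affN -> R[i]) : Prop := (l2norm2 xi < +oo)%E.

Definition l2basis (x : affN) : affN -> R[i] := fun y => (y == x)%:R.

(* pi is an isometric unital *-representation of A on l^2(N ><| N^x). The
   operator pi a only matters on square-summable functions, and adjoints are
   compared through matrix entries: (pi a e_y) x = < pi a e_y, e_x >. *)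
Record l2_rep (A : cstarType R)
    (pi : A -> (affN -> R[i]) -> affN -> R[i]) : Prop := {
  l2_rep_op : forall a (c : R[i]) xi eta, in_l2 xi -> in_l2 eta ->
    pi a (fun x => c * xi x + eta x) = fun x => c * pi a xi x + pi a eta x;
  l2_rep_norm : forall a (M : R), 0 <= M ->
    (cnorm a <= M) <->
    (forall xi, in_l2 xi -> (l2norm2 (pi a xi) <= (M ^+ 2)%:E * l2norm2 xi)%E);
  l2_rep_linear : forall (c : R[i]) a b xi, in_l2 xi ->
    pi (c *: a + b) xi = fun x => c * pi a xi x + pi b xi x;
  l2_rep_one : forall xi, in_l2 xi -> pi 1 xi = xi;
  l2_rep_mul : forall a b xi, in_l2 xi -> pi (a * b) xi = pi a (pi b xi);
  l2_rep_star : forall a x y,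
    pi (star a) (l2basis x) y = (pi a (l2basis y) x)^*
}.

(* The C*-algebra generated by the shifts w_y e_x = e_(yx) on l^2. *)
Definition is_toeplitz_algebra (A : cstarType R) (w : affN -> A) : Prop :=
  cstar_generated (range w) /\
  exists pi : A -> (affN -> R[i]) -> affN -> R[i],
    l2_rep pi /\ forall x y, pi (w y) (l2basis x) = l2basis (affNM y x).

End Toeplitz.

Section CuntzQN.
Variable R : realType.

Record QN_relations (A : cstarType R) (s : A) (u : posnat -> A) : Prop := {
  QN_unitary : star s * s = 1 /\ s * star s = 1;
  QN_isometry : forall a, star (u a) * u a = 1;
  QN_us : forall a, u a * s = s ^+ sval a * u a;
  QN_uu : forall a b, u a * u b = u (posnatM a b);
  QN_sum : forall a,
    \sum_(k < sval a) s ^+ k * u a * star (u a) * star s ^+ k = 1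
}.

Definition is_QN (A : cstarType R) (s : A) (u : posnat -> A) : Prop :=
  [/\ QN_relations s u,
      cstar_generated (s |` range u) &
      forall (B : cstarType R) (s' : B) (u' : posnat -> B),
        QN_relations s' u' ->
        exists! phi : A -> B,
          [/\ star_hom phi, phi s = s' & forall a, phi (u a) = u' a]].

End CuntzQN.

(* Main.v *)
(* The maximal elements of Omega are the sets {(m, a) : m = r mod a} with r a
   profinite integer, so C(dOmega) consists of the continuous functions of r,
   in which the sets {r = k mod a} are clopen and the integers are dense. On the
   boundary the images of w_(1,1) and w_(0,a) satisfy the relations of Q_N,
   which gives phi : Q_N -> B. For its inverse one represents the partial
   crossed product in Q_N: a function f on the boundary goes to the limit, along
   a ordered by divisibility, of the sums
   sum_(k < a) f(k) s^k u_a u_a^* s^(-k), and delta_g goes to the partial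
   isometry of Q_N that acts on the isometries s^i u_a as g acts on Z x| N^x.
   This needs the projections s^k u_a u_a^* s^(-k), k < a, to be orthogonal,
   which follows from their sum being 1 because a projection is an extreme
   point of the unit ball of its corner, and the bound |f| for such sums, which
   follows by writing a real f with |f| <= 1 as the real part of the unitary
   f + i sqrt(1 - f^2). *)
Require Import Defs.
From mathcomp Require Import all_boot all_order all_algebra complex.
From mathcomp Require Import all_classical all_reals all_analysis.
From mathcomp Require Import ring lra zify.

Set Implicit Arguments.
Unset Strict Implicit.
Unset Printing Implicit Defensive.

Import Order.TTheory GRing.Theory Num.Theory numFieldNormedType.Exports.
Local Open Scope classical_set_scope.
Local Open Scope ring_scope.

(** * Norm estimates in C*-algebras *)

(** The norm estimates use only the C*-identity, the triangle inequality and products of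
    contractions, never spectra or positivity. Elements of Q_N are compared by their products with
    the isometries s^k u_c, 0 <= k < c, which determine an element because their range projections
    sum to 1. Replacing k by k + c q multiplies such an isometry on the right by s^q, so they are
    indexed by integers and not by residues. A group element g is treated as a partial map of Z,
    defined at i only if g i is an integer. Its partial isometry V_g therefore satisfies V_g V_h =
    V_g V_(g^-1) V_(g h) rather than V_g V_h = V_(g h); the range projection left over is absorbed
    by the coefficient function, which vanishes outside the range of g. A finite diagonal sum is not
    covariant, since g moves the representatives 0, ..., a - 1 elsewhere in their classes;
    covariance appears in the limit, by uniform continuity. That the two homomorphisms are inverse
    to each other follows on one side from the universal property of Q_N, on the other from the fact
    that a representation over the boundary is determined by the images of the w_p. *)

Section ComplexModulus.
Variable R : realType.
Implicit Types z : R[i].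

(** The modulus as an element of [R], where [cnorm] takes its values; the norm of [z] itself lies in
    R[i]. *)
Definition cabs z : R := complex.Re `|z|.

Lemma cabsC z : (cabs z)%:C%C = `|z|.
Proof. by rewrite /cabs RRe_real // normr_real. Qed.

Lemma cabs_ge0 z : 0 <= cabs z.
Proof. by rewrite -(@ler0c R) cabsC. Qed.

Lemma cabs0 : cabs 0 = 0.
Proof. by rewrite /cabs normr0. Qed.

Lemma cabsN z : cabs (- z) = cabs z.
Proof. by rewrite /cabs normrN. Qed.

Lemma cabsM z z' : cabs (z * z') = cabs z * cabs z'.
Proof. by apply: (@complexI R); rewrite rmorphM /= !cabsC normrM. Qed.

Lemma cabsD z z' : cabs (z + z') <= cabs z + cabs z'.
Proof. by rewrite -(@lecR R) rmorphD /= !cabsC ler_normD. Qed.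

Lemma cabs_conj z : cabs z^* = cabs z.
Proof. by rewrite /cabs norm_conjC. Qed.

Lemma cabs_real (x : R) : cabs x%:C%C = `|x|.
Proof. by rewrite /cabs normc_def /= expr0n addr0 sqrtr_sqr. Qed.

Lemma Re_le_cabs z : `|complex.Re z| <= cabs z.
Proof.
case: z => a b; rewrite /cabs normc_def /= -(sqrtr_sqr a).
by rewrite ler_wsqrtr// lerDl sqr_ge0.
Qed.

Lemma Im_le_cabs z : `|complex.Im z| <= cabs z.
Proof.
case: z => a b; rewrite /cabs normc_def /= -(sqrtr_sqr b).
by rewrite ler_wsqrtr// lerDr sqr_ge0.
Qed.

End ComplexModulus.

Section CStarNorm.
Variables (R : realType) (A : cstarType R).
Implicit Types (x y d e p : A) (r : R).

Lemma cnormZr r x : cnorm (r%:C%C *: x) = `|r| * cnorm x.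
Proof. by rewrite cnormZ -/(cabs _) cabs_real. Qed.

Lemma cnorm0 : cnorm (0 : A) = 0.
Proof. by rewrite -(scale0r (0 : A)) cnormZ normr0 /= mul0r. Qed.

Lemma cnormN x : cnorm (- x) = cnorm x.
Proof. by rewrite -scaleN1r cnormZ normrN normr1 /= mul1r. Qed.

Lemma cnorm_ge0 x : 0 <= cnorm x.
Proof.
have := ler_cnormD x (- x); rewrite subrr cnorm0 cnormN.
by rewrite -mulr2n pmulrn_lge0.
Qed.

Lemma ler_cnormB x y : cnorm (x - y) <= cnorm x + cnorm y.
Proof. by rewrite -(cnormN y) ler_cnormD. Qed.

Lemma cnormBC x y : cnorm (x - y) = cnorm (y - x).
Proof. by rewrite -cnormN opprB. Qed.

Lemma star1 : star (1 : A) = 1.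
Proof. by rewrite -[LHS]mulr1 -{2}[1]starK -starM mulr1 starK. Qed.

Lemma star0 : star (0 : A) = 0.
Proof. by apply: (addrI (star 0)); rewrite -starD !addr0. Qed.

Lemma starN x : star (- x) = - star x.
Proof. by apply: (addrI (star x)); rewrite -starD !subrr star0. Qed.

Lemma starB x y : star (x - y) = star x - star y.
Proof. by rewrite starD starN. Qed.

Lemma star_sum (I : Type) (r : seq I) (P : pred I) (F : I -> A) :
  star (\sum_(i <- r | P i) F i) = \sum_(i <- r | P i) star (F i).
Proof. by elim/big_rec2: _ => [|i x y _ <-]; rewrite ?star0 ?starD. Qed.

Lemma cnorm_sum (I : Type) (r : seq I) (P : pred I) (F : I -> A) :
  cnorm (\sum_(i <- r | P i) F i) <= \sum_(i <- r | P i) cnorm (F i).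
Proof.
elim/big_rec2: _ => [|i x y _ le_yx]; first by rewrite cnorm0.
by rewrite (le_trans (ler_cnormD _ _))// lerD2l.
Qed.

Lemma star_exp x (n : nat) : star (x ^+ n) = star x ^+ n.
Proof.
by elim: n => [|n IHn]; rewrite ?star1// exprS starM IHn exprSr.
Qed.

Lemma cnorm_star x : cnorm (star x) = cnorm x.
Proof.
have le y : cnorm y <= cnorm (star y).
  have [->|y0] := eqVneq y 0; first by rewrite star0.
  have ny : 0 < cnorm y.
    rewrite lt_neqAle cnorm_ge0 andbT eq_sym.
    by apply: contra_neq y0 => /cnorm0_eq0.
  by rewrite -(ler_pM2r ny) -expr2 -cnorm_star_mul ler_cnormM.
by apply/eqP; rewrite eq_le le andbT -{2}[x]starK le.
Qed.

(** Identities between limits are proved through this. Testing at e / (|K| + 1) spares the caller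
    any check on the sign of [K]. *)
Lemma cnorm_eps_eq0 x (K : R) :
  (forall e : R, 0 < e -> cnorm x <= K * e) -> x = 0.
Proof.
move=> small; apply: cnorm0_eq0; apply/eqP; rewrite eq_le cnorm_ge0 andbT.
apply/ler_addgt0Pr => e e0; rewrite add0r.
have K0 : 0 < `|K| + 1 by rewrite ltr_wpDl.
apply: (le_trans (small _ (divr_gt0 e0 K0))).
rewrite mulrA ler_pdivrMr// mulrC ler_pM2l//.
by rewrite (le_trans (ler_norm _))// lerDl.
Qed.

Lemma cnorm_proj_le1 p : star p = p -> p * p = p -> cnorm p <= 1.
Proof.
move=> sp pp; have := cnorm_star_mul p; rewrite sp pp expr2.
have [->|pn0] := eqVneq (cnorm p) 0; first by rewrite ler01.
by rewrite -{1}[cnorm p]mul1r => /(mulIf pn0) <-.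
Qed.

Lemma cnorm_one_le1 : cnorm (1 : A) <= 1.
Proof. by rewrite cnorm_proj_le1 ?star1 ?mulr1. Qed.

Lemma cnorm_isometry_le1 x : star x * x = 1 -> cnorm x <= 1.
Proof.
move=> xx; rewrite -(@expr_le1 _ 2%N)// ?cnorm_ge0//.
by rewrite -cnorm_star_mul xx cnorm_one_le1.
Qed.

Lemma cnorm_mul_le1 x y : cnorm x <= 1 -> cnorm y <= 1 -> cnorm (x * y) <= 1.
Proof.
move=> x1 y1; rewrite (le_trans (ler_cnormM x y))//.
by rewrite mulr_ile1 ?cnorm_ge0.
Qed.

Lemma star_mul_eq0 x : star x * x = 0 -> x = 0.
Proof.
move=> xx; apply: cnorm0_eq0; apply/eqP.
by rewrite -(@sqrf_eq0 R) -cnorm_star_mul xx cnorm0.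
Qed.

(* [a + i b] is unitary and [a] is the mean of it and its adjoint. *)
Lemma cnorm_sum_squares (a b : A) : star a = a -> star b = b -> a * b = b * a ->
  a * a + b * b = 1 -> cnorm a <= 1.
Proof.
move=> sa sb ab aabb; pose v := a + 'i *: b.
have sv : star v = a - 'i *: b.
  by rewrite starD starZ sa sb conjCi scaleNr.
have ax : a * ('i *: b) = ('i *: b) * a by rewrite -scalerAl -scalerAr ab.
have xx : ('i *: b) * ('i *: b) = - (b * b).
  by rewrite -scalerAl -scalerAr scalerA -expr2 sqrCi scaleN1r.
have svv : star v * v = 1.
  by rewrite sv mulrDr !mulrBl -ax addrA subrK xx opprK.
have vsv : star (star v) * star v = 1.
  by rewrite starK sv mulrBr !mulrDl ax opprD addrA addrK xx opprK.
have -> : a = 2^-1 *: (v + star v).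
  rewrite sv addrACA subrr addr0 -mulr2n -(scaler_nat 2 a) scalerA.
  by rewrite mulVf ?scale1r// pnatr_eq0.
have -> : (2^-1 : R[i]) = (2^-1 : R)%:C%C by rewrite fmorphV rmorph_nat.
rewrite cnormZr ger0_norm ?invr_ge0// ler_pdivrMl// mulr1.
by rewrite (le_trans (ler_cnormD _ _))// lerD// cnorm_isometry_le1.
Qed.

(* With [zeta] a primitive 8th root of unity, [|e + zeta d|^2] is the norm of
   the convex combination [e + sqrt 2 d + d^2] of [(e + d)^2] and
   [(e - d)^2]; and [e + sqrt 2 d] is the mean of the squares of [e + zeta d]
   and of its adjoint. *)
Lemma cnorm_dilate e d : star e = e -> e * e = e -> star d = d ->
  e * d = d -> d * e = d -> cnorm (e + d) <= 1 -> cnorm (e - d) <= 1 ->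
  cnorm (e + (Num.sqrt 2 : R)%:C%C *: d) <= 1.
Proof.
move=> se ee sd ed de ned1 ned2.
pose r : R := Num.sqrt 2; rewrite -/r.
have rr : r * r = 2 by rewrite -expr2 sqr_sqrtr.
have r0 : 0 < r by rewrite sqrtr_gt0.
have r2 : r <= 2 by clearbody r; nra.
(* Polynomials of degree at most 2 in [d], with [e] as unit: the identities below become identities
   between their coefficients. *)
pose L (a b c : R[i]) : A := a *: e + b *: d + c *: (d * d).
have LD a b c a' b' c' : L a b c + L a' b' c' = L (a + a') (b + b') (c + c').
  by rewrite /L !scalerDl addrACA [X in X + _]addrACA.
have LZ k a b c : k *: L a b c = L (k * a) (k * b) (k * c).
  by rewrite /L !scalerDr !scalerA.
have LM a b a' b' : L a b 0 * L a' b' 0 = L (a * a') (a * b' + b * a') (b * b').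
  rewrite /L !scale0r !addr0 mulrDl !mulrDr -!scalerAl -!scalerAr ee ed de.
  rewrite !scalerA !scalerDl !addrA; congr (_ + _).
have sL a b : star (L a b 0) = L a^* b^* 0.
  by rewrite /L !scale0r !addr0 starD !starZ se sd.
have eDd : e + d = L 1 1 0 by rewrite /L !scale1r scale0r addr0.
have eBd : e - d = L 1 (-1) 0 by rewrite /L scale1r scaleN1r scale0r addr0.
pose rc : R[i] := r%:C%C.
have rrc : rc * rc = 2 by rewrite /rc -rmorphM rr rmorph_nat.
have rcV : rc^-1 = rc / 2.
  have rc0 : rc != 0 by apply/eqP => rc0; move: rrc; rewrite rc0 mul0r => /eqP;
    rewrite eq_sym pnatr_eq0.
  by apply: (mulfI rc0); rewrite mulfV// mulrA rrc mulfV// pnatr_eq0.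
have crc : rc^* = rc by apply/CrealP; rewrite complex_real.
have ii : ('i : R[i]) * 'i = -1 by rewrite -expr2 sqrCi.
pose z : R[i] := rc / 2 * (1 + 'i).
pose z' : R[i] := rc / 2 * (1 - 'i).
have zc : z^* = z'.
  by rewrite /z /z' !rmorphM rmorphD /= conjCi crc rmorph1 fmorphV rmorph_nat.
have n2 : (2 : R[i]) != 0 by rewrite pnatr_eq0.
have zz' : z * z' = 1.
  transitivity (rc * rc / 4 * (1 - 'i * 'i)); first by rewrite /z /z'; field.
  by rewrite rrc ii; field.
have zDz' : z + z' = rc by rewrite /z /z'; field.
have zz : z * z + z' * z' = 0.
  transitivity (rc * rc / 2 * (1 + 'i * 'i)); first by rewrite /z /z'; field.
  by rewrite ii subrr mulr0.
pose y := L 1 z 0; pose y' := L 1 z' 0.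
have sy : star y = y' by rewrite sL rmorph1 zc.
have sy' : star y' = y by rewrite -sy starK.
have n1 : cnorm (star y * y) <= 1.
  (* The coefficient of [d] in the combination is 4 t - 2, which this weight makes equal to sqrt
     2. *)
  pose t : R := (1 + r / 2) / 2.
  have t0 : 0 <= t by rewrite /t; lra.
  have t1 : 0 <= 1 - t by rewrite /t; lra.
  have -> : star y * y =
      t%:C%C *: ((e + d) * (e + d)) + (1 - t)%:C%C *: ((e - d) * (e - d)).
    have tE : t%:C%C = (1 + rc / 2) / 2.
      by rewrite /t !(rmorphM, fmorphV, rmorphD, rmorph1, rmorph_nat).
    have -> : (1 - t)%:C%C = 1 - t%:C%C by rewrite rmorphB rmorph1.
    rewrite sy eDd eBd tE !LM !LZ LD; congr L.
    - by rewrite !mulr1; field.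
    - by rewrite mulr1 mul1r zDz'; field.
    - by rewrite mulrC zz'; field.
  rewrite (le_trans (ler_cnormD _ _))// !cnormZr !ger0_norm//.
  rewrite -[leRHS](subrKC t); apply: lerD; apply: ler_piMr => //;
    exact: cnorm_mul_le1.
have ny : cnorm y <= 1.
  by rewrite -(@expr_le1 _ 2%N)// ?cnorm_ge0// -cnorm_star_mul.
have ny' : cnorm y' <= 1.
  rewrite -(@expr_le1 _ 2%N)// ?cnorm_ge0// -cnorm_star_mul sy'.
  have -> : y * y' = star y * y by rewrite sy !LM; congr L; ring.
  by [].
have -> : e + rc *: d = (2^-1 : R)%:C%C *: (y * y + y' * y').
  rewrite !LM LD LZ fmorphV rmorph_nat -zDz' mulr1 zz mulr0 /L scale0r addr0.
  by congr (_ + _ *: _); [rewrite mulVf// scale1r|field].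
rewrite cnormZr ger0_norm ?invr_ge0// ler_pdivrMl// mulr1.
by rewrite (le_trans (ler_cnormD _ _))// lerD// cnorm_mul_le1.
Qed.

(** By [cnorm_dilate] the hypotheses persist when [d] is replaced by sqrt 2 times [d]. Under
    iteration the perturbation grows geometrically, yet its norm stays at most 2. *)
Lemma projection_extreme e d : star e = e -> e * e = e -> star d = d ->
  e * d = d -> d * e = d -> cnorm (e + d) <= 1 -> cnorm (e - d) <= 1 -> d = 0.
Proof.
move=> se ee sd ed de n1 n2; pose r : R := Num.sqrt 2.
have r0 : 0 <= r by rewrite sqrtr_ge0.
have bound k : cnorm (e + (r ^+ k)%:C%C *: d) <= 1 /\
               cnorm (e - (r ^+ k)%:C%C *: d) <= 1.
  elim: k => [|k [IH1 IH2]]; first by rewrite expr0 scale1r.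
  set c := (r ^+ k)%:C%C in IH1 IH2.
  have cc : c^* = c by apply/CrealP; rewrite complex_real.
  (* A general self-conjugate scalar, so that it serves for [c] and for [- c]. *)
  have key (s : R[i]) : s^* = s -> cnorm (e + s *: d) <= 1 ->
      cnorm (e - s *: d) <= 1 -> cnorm (e + r%:C%C *: (s *: d)) <= 1.
    move=> ss; apply: cnorm_dilate => //; rewrite ?starZ ?ss ?sd//.
      by rewrite -scalerAr ed.
    by rewrite -scalerAl de.
  rewrite exprS rmorphM /= -/c -scalerA; split; first exact: key.
  rewrite -scalerN -scaleNr; apply: key; rewrite ?scaleNr ?opprK//.
  by rewrite rmorphN /= cc.
apply: cnorm0_eq0; apply/eqP; rewrite eq_le cnorm_ge0 andbT leNgt.
apply/negP => d0.
(* Even exponents turn the factor into 2^k, which outgrows every bound. *)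
have rk k : r ^+ (2 * k) * cnorm d <= 2.
  rewrite -[X in X * _]ger0_norm ?exprn_ge0// -cnormZr.
  rewrite -[X in cnorm X](addKr e) addrC.
  rewrite (le_trans (ler_cnormD _ _))// cnormN lerD//; last exact: cnorm_proj_le1.
  by case: (bound (2 * k)%N).
have := archi_boundP (ltW (divr_gt0 (ltr0Sn R 1) d0)).
set n := Num.bound _; rewrite ltr_pdivrMr// => lt2n.
suff : n%:R * cnorm d <= 2 by rewrite leNgt lt2n.
apply: le_trans (rk n); rewrite ler_pM2r// exprM.
have -> : r ^+ 2 = 2 by rewrite sqr_sqrtr.
by rewrite -natrX ler_nat ltnW// ltn_expl.
Qed.

(* In the corner [p_i A p_i] the elements [p_i p_k p_i], k != i, add up to 0,
   so that [p_i p_j p_i], divided by the number of projections, meets the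
   hypotheses of projection_extreme. *)
Lemma projection_sum_orthogonal (n : nat) (p : 'I_n -> A) :
  (forall i, star (p i) = p i) -> (forall i, p i * p i = p i) ->
  \sum_i p i = 1 -> forall i j, i != j -> p i * p j = 0.
Proof.
move=> sp pp p1 i j ij.
pose a k := p i * p k * p i.
have n0 : (0 < n)%N := leq_ltn_trans (leq0n i) (ltn_ord i).
have sum0 : \sum_(k | k != i) a k = 0.
  have : p i * (\sum_k p k) * p i = p i by rewrite p1 mulr1 pp.
  rewrite mulr_sumr mulr_suml (bigD1 i)//= !pp -[RHS]addr0.
  exact: addrI.
(* This is the compression by p_i of the projection 1 - p_k. *)
have na k : cnorm (p i - a k) <= 1.
  have -> : p i - a k = p i * (1 - p k) * p i by rewrite mulrBr mulr1 mulrBl pp.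
  rewrite !cnorm_mul_le1// cnorm_proj_le1 ?starB ?star1 ?sp//.
  by rewrite mulrBr mulr1 mulrBl mul1r pp subrr subr0.
have Ea : p i * a j = a j by rewrite /a !mulrA pp.
have aE : a j * p i = a j by rewrite /a -!mulrA pp.
have sa : star (a j) = a j by rewrite /a !starM !sp mulrA.
pose N : R := n%:R.
have N0 : 0 < N by rewrite ltr0n.
have NN : N%:C%C = n%:R by rewrite rmorph_nat.
pose d := (N^-1)%:C%C *: a j.
have Nd : N%:C%C *: d = a j by rewrite /d scalerA -rmorphM mulfV ?gt_eqF ?scale1r.
have cc : ((N^-1)%:C%C)^* = (N^-1)%:C%C :> R[i] by apply/CrealP; rewrite complex_real.
have scale x : cnorm (N%:C%C *: x) <= N -> cnorm x <= 1.
  by rewrite cnormZr gtr0_norm// -[leRHS]mulr1 ler_pM2l.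
have sumd : \sum_(k | (k != i) && (k != j)) a k = - a j.
  move: sum0; rewrite (bigD1 j)/= 1?eq_sym// => /eqP.
  by rewrite addr_eq0 => /eqP ->; rewrite opprK.
pose m := #|[pred k | (k != i) && (k != j)]|.
have mn : (m.+2 = n)%N.
  rewrite -[RHS]card_ord (cardD1 i) (cardD1 j) !inE eq_sym ij /=.
  by rewrite !add1n; congr _.+2; apply: eq_card => k; rewrite !inE andbT andbC.
have NE : N = m.+2%:R by rewrite mn.
(* The vanishing sum replaces a_j by the -a_k of the n - 2 other indices, leaving p_i twice and n -
   2 contractions p_i - a_k. The triangle inequality alone would give n + 1. *)
have np : cnorm (m.+2%:R *: p i + a j) <= N.
  have -> : m.+2%:R *: p i + a j =
      p i + p i + \sum_(k | (k != i) && (k != j)) (p i - a k).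
    rewrite sumrB sumd opprK sumr_const -/m -(scaler_nat m (p i)) addrA; congr (_ + _).
    by rewrite -addn2 natrD scalerDl addrC [2%:R *: _]scaler_nat mulr2n.
  have n1 : cnorm (p i) <= 1 by rewrite cnorm_proj_le1.
  rewrite NE -(addn2 m) natrD [leRHS]addrC.
  rewrite (le_trans (ler_cnormD _ _))// lerD//.
    by rewrite (le_trans (ler_cnormD _ _))// lerD.
  rewrite (le_trans (cnorm_sum _ _ _))// -sumr_const; exact: ler_sum.
have nm : cnorm (m.+2%:R *: p i - a j) <= N.
  have -> : m.+2%:R *: p i - a j = m.+1%:R *: p i + (p i - a j).
    by rewrite -addn1 natrD scalerDl scale1r addrA.
  rewrite NE -(addn1 m.+1) natrD (le_trans (ler_cnormD _ _))// lerD//.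
  have -> : (m.+1%:R : R[i]) = (m.+1%:R : R)%:C%C by rewrite rmorph_nat.
  rewrite cnormZr normr_nat -[leRHS]mulr1 ler_pM2l ?ltr0n//.
  exact: cnorm_proj_le1.
have d0 : d = 0.
  apply: (@projection_extreme (p i)) => //.
  - by rewrite /d starZ cc sa.
  - by rewrite /d -scalerAr Ea.
  - by rewrite /d -scalerAl aE.
  - by apply: scale; rewrite scalerDr Nd NN -mn.
  - by apply: scale; rewrite scalerBr Nd NN -mn.
have a0 : a j = 0 by rewrite -Nd d0 scaler0.
(* The vanishing element p_i p_j p_i is x^* x for x = p_j p_i. *)
have : p j * p i = 0.
  by apply: star_mul_eq0; rewrite starM !sp mulrA -(mulrA (p i)) pp.
by move=> /(congr1 star); rewrite starM !sp star0.
Qed.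

End CStarNorm.

(** * The affine action on the integers *)

Lemma posnat_eq (a b : posnat) : sval a = sval b -> a = b.
Proof. by move=> ab; apply: val_inj. Qed.

Lemma posnat_gt0 (a : posnat) : (0 < sval a)%N.
Proof. exact: (svalP a). Qed.

Definition mkpos (n : nat) (n0 : (0 < n)%N) : posnat :=
  exist (fun a : nat => 0 < a)%N n n0.

Section Residues.

Definition residue (i : int) (c : posnat) : int := (i %% (sval c)%:Z)%Z.

Lemma posnatZ_neq0 (c : posnat) : (sval c)%:Z != 0.
Proof. by have := posnat_gt0 c; lia. Qed.

Lemma residue_ord (i : int) (c : posnat) :
  exists k : 'I_(sval c), residue i c = k%:Z.
Proof.
have h0 : 0 <= residue i c by rewrite modz_ge0 ?posnatZ_neq0.
have h1 : residue i c < (sval c)%:Z.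
  by rewrite ltz_pmod// ltz_nat posnat_gt0.
have lt : (absz (residue i c) < sval c)%N by lia.
by exists (Ordinal lt) => /=; rewrite gez0_abs.
Qed.

Lemma residue_id (c : posnat) (k : 'I_(sval c)) : residue k%:Z c = k%:Z.
Proof. by rewrite /residue modz_small// ltz_nat ltn_ord. Qed.

Lemma residueE (i : int) (c : posnat) :
  exists q : int, i = residue i c + (sval c)%:Z * q.
Proof.
by exists (i %/ (sval c)%:Z)%Z; rewrite {1}(divz_eq i (sval c)%:Z) addrC mulrC.
Qed.

Lemma dvdz_residue (i : int) (c : posnat) : ((sval c)%:Z %| residue i c - i)%Z.
Proof.
have [q {2}->] := residueE i c.
by rewrite opprD addrA subrr add0r -mulrN dvdz_mulr.
Qed.

Lemma residue_eq (i j : int) (c : posnat) :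
  ((sval c)%:Z %| i - j)%Z -> residue i c = residue j c.
Proof. by rewrite -eqz_mod_dvd => /eqP. Qed.

Lemma dvdz_addP (i j : int) (c : posnat) :
  reflect (exists q, j = i + (sval c)%:Z * q) ((sval c)%:Z %| j - i)%Z.
Proof.
apply: (iffP dvdzP) => -[q jE]; exists q; first by rewrite mulrC -jE subrKC.
by rewrite jE addrC addKr mulrC.
Qed.

End Residues.

Section AffineAction.
Implicit Types (g h : affQ) (c d : posnat).

(** A relation rather than a function, because an affine map of Q sends only some integers to
    integers. *)
Definition affZ g (i j : int) : Prop :=
  j%:~R = g.1 + sval g.2 * i%:~R :> rat.
(** Moving an integer by [c] moves its image by [d], so [g] carries classes modulo [c] to classes
    modulo [d] ([affZ_shift]). *)
Definition affmod g c d : Prop :=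
  (sval d)%:R = sval g.2 * (sval c)%:R :> rat.

Lemma affQ_scale_neq0 g : sval g.2 != 0.
Proof. by rewrite gt_eqF//; exact: svalP g.2. Qed.

Lemma affZ_fun g i j k : affZ g i j -> affZ g i k -> j = k.
Proof. by rewrite /affZ => <- /eqP; rewrite eqr_int => /eqP. Qed.

Lemma affZV g i j : affZ g i j -> affZ g^-1%g j i.
Proof.
rewrite /affZ => -> /=; rewrite mulrDr addKr mulKf//.
exact: affQ_scale_neq0.
Qed.

Lemma affZVK g i j : affZ g^-1%g j i -> affZ g i j.
Proof. by move/affZV; rewrite invgK. Qed.

Lemma affZM g h i j k : affZ h i j -> affZ g j k -> affZ (g * h)%g i k.
Proof. by rewrite /affZ => jE -> /=; rewrite jE mulrDr addrA mulrA. Qed.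

Lemma affZMl g h i j k : affZ h i j -> affZ (g * h)%g i k -> affZ g j k.
Proof. by move=> /affZV ji /(affZM ji); rewrite mulgK. Qed.

Lemma affZMr g h i j k : affZ g j k -> affZ (g * h)%g i k -> affZ h i j.
Proof. by move=> /affZV kj ik; have := affZM ik kj; rewrite mulKg. Qed.

Lemma affmodV g c d : affmod g c d -> affmod g^-1%g d c.
Proof. by rewrite /affmod => -> /=; rewrite mulKf// affQ_scale_neq0. Qed.

Lemma affmodMr g c d e :
  affmod g c d -> affmod g (posnatM c e) (posnatM d e).
Proof. by rewrite /affmod /= !natrM mulrA => ->. Qed.

(** The pair is the denominator and the numerator of the scale in lowest terms; Gauss's lemma makes
    every other pair a multiple of it. *)
Lemma affmod_min g : exists c d, affmod g c d /\
  forall c' d', affmod g c' d' ->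
    exists e, c' = posnatM c e /\ d' = posnatM d e.
Proof.
have g0 : 0 < sval g.2 by exact: svalP g.2.
have n0 : (0 < absz (numq (sval g.2)))%N.
  by rewrite absz_gt0 numq_eq0 affQ_scale_neq0.
have d0 : (0 < absz (denq (sval g.2)))%N by rewrite absz_gt0 denq_neq0.
have nE : (absz (numq (sval g.2)))%:R =
    sval g.2 * (absz (denq (sval g.2)))%:R :> rat.
  rewrite !pmulrn !gez0_abs ?denq_ge0// ?numq_ge0 ?ltW//.
  by rewrite -{2}[sval g.2]divq_num_den divfK// intr_eq0 denq_neq0.
exists (mkpos d0), (mkpos n0); split; first exact: nE.
move=> c d cd.
have E : (sval d * absz (denq (sval g.2)) =
    absz (numq (sval g.2)) * sval c)%N.
  by apply/eqP; rewrite -(@eqr_nat rat) !natrM nE cd mulrAC.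
have /dvdnP[e cE] : (absz (denq (sval g.2)) %| sval c)%N.
  rewrite -(@Gauss_dvdr _ (absz (numq (sval g.2)))) -?E ?dvdn_mull//.
  by rewrite coprime_sym coprime_num_den.
have e0 : (0 < e)%N by move: (posnat_gt0 c); rewrite cE muln_gt0 => /andP[].
exists (mkpos e0); split; apply: posnat_eq; rewrite /=; first by rewrite mulnC.
by apply/eqP; rewrite -(eqn_pmul2r d0) E cE mulnA.
Qed.

Lemma affmod_comp g h : exists c d e, affmod h c d /\ affmod g d e.
Proof.
have [c [d [cd _]]] := affmod_min h; have [a [b [ab _]]] := affmod_min g.
exists (posnatM c a), (posnatM d a), (posnatM b d); split.
  exact: affmodMr.
have -> : posnatM d a = posnatM a d by apply: posnat_eq; rewrite /= mulnC.
exact: affmodMr.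
Qed.

Lemma affZ_shift g c d i j q : affmod g c d -> affZ g i j ->
  affZ g (i + (sval c)%:Z * q) (j + (sval d)%:Z * q).
Proof.
rewrite /affmod /affZ => cd ij.
by rewrite !intrD !intrM ij -!pmulrn cd mulrDr addrA mulrA.
Qed.

Lemma affZ_dvdz g c d i j k l : affmod g c d -> affZ g i j -> affZ g k l ->
  ((sval c)%:Z %| k - i)%Z = ((sval d)%:Z %| l - j)%Z.
Proof.
move=> cd ij kl; apply/dvdz_addP/dvdz_addP => -[q E]; exists q.
  by apply: (affZ_fun kl); rewrite E; apply: affZ_shift.
apply: (affZ_fun (affZV kl)); rewrite E; apply: affZ_shift (affZV ij).
exact: affmodV.
Qed.

End AffineAction.

(** * The isometries of Q_N *)

Section QNAlgebra.
Variables (R : realType) (A : cstarType R) (s : A) (u : posnat -> A).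
Hypothesis rel : QN_relations s u.
Implicit Types (c d : posnat) (i j k q : int).

Definition spow i : A :=
  match i with Posz n => s ^+ n | Negz n => star s ^+ n.+1 end.

Let ss : star s * s = 1. Proof. by case: (QN_unitary rel). Qed.
Let ss' : s * star s = 1. Proof. by case: (QN_unitary rel). Qed.

Lemma spow_nat (n : nat) : spow n%:Z = s ^+ n.
Proof. by []. Qed.

Lemma spowS i : spow (i + 1) = spow i * s.
Proof.
case: i => [n|[|n]]; first by rewrite -PoszD addn1 /= exprSr.
  by rewrite /= expr1 ss.
have -> : Negz n.+1 + 1 = Negz n by lia.
by rewrite /= (exprSr _ n.+1) -mulrA ss mulr1.
Qed.

Lemma spowP i : spow (i - 1) = spow i * star s.
Proof. by rewrite -{2}(subrK 1 i) spowS -mulrA ss' mulr1. Qed.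

Lemma spowD i j : spow (i + j) = spow i * spow j.
Proof.
elim/int_rec: j => [|n IHn|n IHn]; first by rewrite addr0 /= expr0 mulr1.
  by rewrite -addn1 PoszD addrA !spowS IHn mulrA.
by rewrite -addn1 PoszD opprD addrA !spowP IHn mulrA.
Qed.

Lemma spowVr i : spow (- i) * spow i = 1.
Proof. by rewrite -spowD addNr. Qed.

Lemma star_spow i : star (spow i) = spow (- i).
Proof.
case: i => [[|n]|n]; rewrite /= ?star1 ?star_exp ?starK//.
Qed.

Lemma u_spow c j : u c * spow j = spow ((sval c)%:Z * j) * u c.
Proof.
have natE (n : nat) : u c * spow n%:Z = spow ((sval c)%:Z * n%:Z) * u c.
  elim: n => [|n IHn]; first by rewrite mulr0 /= expr0 mulr1 mul1r.
  rewrite -addn1 PoszD mulrDr mulr1 spowS mulrA IHn -mulrA (QN_us rel).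
  by rewrite spowD spow_nat mulrA.
case: j => [n|n]; first exact: natE.
rewrite NegzE -[LHS]mul1r -(spowVr ((sval c)%:Z * n.+1%:Z)) mulrN -!mulrA.
congr (_ * _); rewrite mulrA -natE -mulrA -spowD subrr /=.
by rewrite expr0 mulr1.
Qed.

Lemma QN_u1 : u posnat1 = 1.
Proof.
have uu : u posnat1 * u posnat1 = u posnat1.
  by rewrite (QN_uu rel); congr u; apply: posnat_eq.
by rewrite -[LHS]mul1r -(QN_isometry rel posnat1) -mulrA uu.
Qed.

(* Locked, since rewriting with [mulrA] would otherwise split the product. *)
Fact wiso_key : unit. Proof. by []. Qed.
Definition wiso i c : A := locked_with wiso_key (spow i * u c).

Lemma wisoE i c : wiso i c = spow i * u c.
Proof. by rewrite /wiso unlock. Qed.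

Lemma wisoM i c j d :
  wiso i c * wiso j d = wiso (i + (sval c)%:Z * j) (posnatM c d).
Proof.
by rewrite !wisoE mulrA -(mulrA (spow i)) u_spow spowD -(QN_uu rel) !mulrA.
Qed.

Lemma wiso_spow i c q : wiso i c * spow q = wiso (i + (sval c)%:Z * q) c.
Proof. by rewrite !wisoE -mulrA u_spow spowD mulrA. Qed.

Lemma star_wiso_mul i c q : star (wiso i c) * wiso (i + (sval c)%:Z * q) c = spow q.
Proof.
rewrite -wiso_spow mulrA -[RHS]mul1r; congr (_ * _).
rewrite !wisoE starM star_spow mulrA -(mulrA (star _)) spowVr mulr1.
exact: (QN_isometry rel).
Qed.

Lemma wiso_isometry i c : star (wiso i c) * wiso i c = 1.
Proof. by have := star_wiso_mul i c 0; rewrite mulr0 addr0. Qed.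

Lemma wiso_complete c :
  \sum_(k < sval c) wiso k%:Z c * star (wiso k%:Z c) = 1.
Proof.
rewrite -[RHS](QN_sum rel c); apply: eq_bigr => k _.
by rewrite !wisoE starM /= star_exp !mulrA.
Qed.

(** Passing to residues splits off unitary powers of [s] on the right. For distinct residues the
    range projections are orthogonal by [projection_sum_orthogonal], and the outer isometries
    cancel. *)
Lemma star_wiso_mul0 i j c :
  ~~ ((sval c)%:Z %| j - i)%Z -> star (wiso i c) * wiso j c = 0.
Proof.
move=> ndiv; have [a iE] := residueE i c; have [b jE] := residueE j c.
have [k kE] := residue_ord i c; have [l lE] := residue_ord j c.
rewrite iE jE -!wiso_spow kE lE starM mulrA -(mulrA _ _ (wiso l%:Z c)).
suff -> : star (wiso k%:Z c) * wiso l%:Z c = 0 by rewrite mulr0 mul0r.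
have kl : k != l.
  apply: contraNneq ndiv => kl; apply/dvdz_addP; exists (b - a).
  by rewrite jE iE kE lE kl mulrBr -addrA subrKC.
have := @projection_sum_orthogonal _ _ _
  (fun k : 'I_(sval c) => wiso k%:Z c * star (wiso k%:Z c)) _ _ _ k l kl.
move=> /(_ _ _ (wiso_complete c)) H.
have {}H : wiso k%:Z c * star (wiso k%:Z c) *
    (wiso l%:Z c * star (wiso l%:Z c)) = 0.
  apply: H => m; first by rewrite starM starK.
  by rewrite mulrA -(mulrA (wiso _ _)) wiso_isometry mulr1.
have := congr1 (fun x => star (wiso k%:Z c) * x * wiso l%:Z c) H.
rewrite mulr0 mul0r 2!(mulrA (star (wiso k%:Z c))) wiso_isometry mul1r.
by rewrite mulrA -(mulrA _ (star (wiso l%:Z c))) wiso_isometry mulr1.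
Qed.

(** Takes the place of evaluation on basis vectors: at a fixed modulus, equality is tested column by
    column. *)
Lemma wiso_ext c (x y : A) :
  (forall k : 'I_(sval c), x * wiso k%:Z c = y * wiso k%:Z c) -> x = y.
Proof.
move=> xy; rewrite -[x]mulr1 -[y]mulr1 -(wiso_complete c) !mulr_sumr.
by apply: eq_bigr => k _; rewrite !mulrA xy.
Qed.

Lemma star_wiso_ext c (x y : A) :
  (forall k : 'I_(sval c), star (wiso k%:Z c) * x = star (wiso k%:Z c) * y) ->
  x = y.
Proof.
move=> xy; rewrite -[x]mul1r -[y]mul1r -(wiso_complete c) !mulr_suml.
by apply: eq_bigr => k _; rewrite -!mulrA xy.
Qed.

Definition wproj i c : A := wiso i c * star (wiso i c).

Lemma wproj_wiso c d i j : (sval c %| sval d)%N ->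
  wproj i c * wiso j d = if ((sval c)%:Z %| j - i)%Z then wiso j d else 0.
Proof.
move=> /dvdnP[e dE]; have e0 : (0 < e)%N.
  by have := posnat_gt0 d; rewrite dE muln_gt0 => /andP[].
have -> : d = posnatM c (mkpos e0) by apply: posnat_eq; rewrite dE mulnC.
case: ifPn => [/dvdz_addP[q ->]|ndiv].
  by rewrite -wisoM /wproj -mulrA (mulrA (star _)) wiso_isometry mul1r.
have -> : wiso j (posnatM c (mkpos e0)) = wiso j c * wiso 0 (mkpos e0).
  by rewrite wisoM mulr0 addr0.
by rewrite /wproj -mulrA (mulrA (star _)) star_wiso_mul0// mul0r mulr0.
Qed.

(** [f] need not be periodic: it is sampled at the representatives 0, ..., c - 1, which is where the
    error terms below come from. *)
Definition wdiag c (f : int -> R[i]) : A :=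
  \sum_(k < sval c) f k%:Z *: wproj k%:Z c.

Lemma wdiag_wiso c d f j : (sval c %| sval d)%N ->
  wdiag c f * wiso j d = f (residue j c) *: wiso j d.
Proof.
move=> cd; have [k kE] := residue_ord j c.
rewrite /wdiag mulr_suml (bigD1 k)//= big1 ?addr0 => [|l lk].
  by rewrite -scalerAl wproj_wiso// -kE -opprB rpredN dvdz_residue.
rewrite -scalerAl wproj_wiso//; case: ifPn; rewrite ?scaler0//.
move=> /residue_eq; rewrite residue_id kE => kl; case/eqP: lk.
by apply: val_inj => /=; case: kl.
Qed.

Lemma wdiag_ord c f (k : 'I_(sval c)) :
  wdiag c f * wiso k%:Z c = f k%:Z *: wiso k%:Z c.
Proof. by rewrite wdiag_wiso// residue_id. Qed.

Lemma wdiag_linear c (a : R[i]) f h :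
  wdiag c (fun i => a * f i + h i) = a *: wdiag c f + wdiag c h.
Proof.
rewrite /wdiag scaler_sumr -big_split; apply: eq_bigr => k _ /=.
by rewrite scalerDl scalerA.
Qed.

Lemma wdiagB c f h :
  wdiag c (fun i => f i - h i) = wdiag c f - wdiag c h.
Proof.
rewrite addrC -scaleN1r -wdiag_linear; congr wdiag; apply/funext => i.
by rewrite mulN1r addrC.
Qed.

Lemma wdiag_mul c f h :
  wdiag c (fun i => f i * h i) = wdiag c f * wdiag c h.
Proof.
apply: (@wiso_ext c) => k.
by rewrite -mulrA !wdiag_ord -scalerAr wdiag_ord scalerA mulrC.
Qed.

Lemma wdiag_star c f : wdiag c (fun i => (f i)^*) = star (wdiag c f).
Proof.
rewrite /wdiag star_sum; apply: eq_bigr => k _.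
by rewrite starZ /wproj starM starK.
Qed.

Lemma wdiag1 c : wdiag c (fun=> 1) = 1.
Proof.
by rewrite -(wiso_complete c); apply: eq_bigr => k _; rewrite scale1r.
Qed.

Lemma eq_wdiag c f h :
  (forall k : 'I_(sval c), f k%:Z = h k%:Z) -> wdiag c f = wdiag c h.
Proof. by move=> fh; apply: eq_bigr => k _; rewrite fh. Qed.

Lemma wdiag_refine c d f : (sval c %| sval d)%N ->
  wdiag c f = wdiag d (fun i => f (residue i c)).
Proof.
by move=> cd; apply: (@wiso_ext d) => k; rewrite wdiag_wiso// wdiag_ord.
Qed.

Lemma wdiag_real_bound c (f : int -> R) (e : R) : 0 < e ->
  (forall k : 'I_(sval c), `|f k%:Z| <= e) ->
  cnorm (wdiag c (fun i => (f i)%:C%C)) <= e.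
Proof.
move=> e0 fe.
pose a := wdiag c (fun i => (f i / e)%:C%C).
pose b := wdiag c (fun i => (Num.sqrt (1 - (f i / e) ^+ 2))%:C%C).
have starE h : star (wdiag c (fun i => (h i)%:C%C)) = wdiag c (fun i => (h i)%:C%C).
  rewrite -wdiag_star; congr wdiag; apply/funext => i.
  by apply/CrealP; rewrite complex_real.
have -> : wdiag c (fun i => (f i)%:C%C) = e%:C%C *: a.
  have -> : a = wdiag c (fun i => (e^-1)%:C%C * (f i)%:C%C + 0).
    by congr wdiag; apply/funext => i; rewrite addr0 -rmorphM mulrC.
  rewrite wdiag_linear scalerDr scalerA -rmorphM mulfV ?gt_eqF// scale1r.
  rewrite -[LHS]addr0; congr (_ + _).
  by rewrite /wdiag big1 ?scaler0// => k _; rewrite scale0r.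
rewrite cnormZr gtr0_norm// ler_piMr ?(ltW e0)//.
apply: (@cnorm_sum_squares _ _ a b); rewrite ?starE//.
  by rewrite -!wdiag_mul; congr wdiag; apply/funext => i; rewrite mulrC.
rewrite -!wdiag_mul -[LHS]scale1r -[X in _ + X]addr0.
have -> : wdiag c (fun i => (f i / e)%:C%C * (f i / e)%:C%C) =
          1 *: wdiag c (fun i => (f i / e)%:C%C * (f i / e)%:C%C).
  by rewrite scale1r.
rewrite addr0 -wdiag_linear scale1r -(wdiag1 c); apply: eq_wdiag => k.
rewrite mul1r -!rmorphM -rmorphD -expr2 -[X in _ + X]expr2 sqr_sqrtr.
  by rewrite subrKC.
rewrite subr_ge0 -real_normK ?num_real// expr_le1 ?normr_ge0//.
by rewrite normrM normfV (gtr0_norm e0) ler_pdivrMr// mul1r.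
Qed.

(** The factor 2 is the price of treating real and imaginary parts separately; it does no harm to
    convergence. *)
Lemma wdiag_bound c f (e : R) : 0 < e ->
  (forall k : 'I_(sval c), cabs (f k%:Z) <= e) -> cnorm (wdiag c f) <= 2 * e.
Proof.
move=> e0 fe.
have -> : wdiag c f = 'i *: wdiag c (fun i => (complex.Im (f i))%:C%C) +
                       wdiag c (fun i => (complex.Re (f i))%:C%C).
  rewrite -wdiag_linear; apply: eq_wdiag => k.
  by rewrite addrC {1}[f _]complexE.
rewrite (le_trans (ler_cnormD _ _))// mulr_natl mulr2n lerD//.
  rewrite cnormZ normCi mul1r; apply: wdiag_real_bound => // k.
  exact: le_trans (Im_le_cabs _) _.
apply: wdiag_real_bound => // k; exact: le_trans (Re_le_cabs _) _.
Qed.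

End QNAlgebra.

(** * Diagonal limits and partial isometries in Q_N *)

Section QNDiagonalLimit.
Variables (R : realType).

(** Equivalently, [f] extends to a continuous function on the profinite integers. *)
Definition profinite_continuous (f : int -> R[i]) : Prop :=
  forall e : R, 0 < e -> exists c : posnat, forall i j,
    ((sval c)%:Z %| i - j)%Z -> cabs (f i - f j) <= e.

Variables (A : cstarType R) (s : A) (u : posnat -> A).
Hypothesis rel : QN_relations s u.
Implicit Types (c d : posnat) (i j k q : int) (f h : int -> R[i]).

Local Notation wiso := (wiso s u).
Local Notation wdiag := (wdiag s u).

Definition diag_lim f (x : A) : Prop :=
  forall e : R, 0 < e -> exists c, forall d, (sval c %| sval d)%N ->
    cnorm (wdiag d f - x) <= e.

Lemma diag_lim_unique f x y : diag_lim f x -> diag_lim f y -> x = y.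
Proof.
move=> fx fy; apply/eqP; rewrite -subr_eq0; apply/eqP.
apply: (@cnorm_eps_eq0 _ _ _ 2) => e e0.
have [c cx] := fx _ e0; have [d dy] := fy _ e0.
rewrite -(subrKA (wdiag (posnatM c d) f)) mulr_natl mulr2n.
rewrite (le_trans (ler_cnormD _ _))// lerD//.
  by rewrite cnormBC cx// dvdn_mulr.
by rewrite dy// dvdn_mull.
Qed.

Lemma diag_cauchy f : profinite_continuous f ->
  forall e : R, 0 < e -> exists c, forall d, (sval c %| sval d)%N ->
    cnorm (wdiag d f - wdiag c f) <= e.
Proof.
move=> fc e e0; have [c cf] := fc _ (divr_gt0 e0 (ltr0n _ 2)).
exists c => d cd; rewrite (wdiag_refine rel f cd) -wdiagB.
have -> : e = 2 * (e / 2) by rewrite mulrC divfK.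
apply: (wdiag_bound rel); first by rewrite divr_gt0.
by move=> k; apply: cf; rewrite -opprB rpredN dvdz_residue.
Qed.

Lemma diag_lim_exists f : profinite_continuous f -> exists x, diag_lim f x.
Proof.
move=> fc; have fact_c (n : nat) : (0 < n`!)%N by exact: fact_gt0.
(* Factorials are cofinal for divisibility, so the net is replaced by a Cauchy sequence. *)
pose x_ n := wdiag (mkpos (fact_c n)) f.
have dvd_c c n : (sval c <= n)%N -> (sval c %| sval (mkpos (fact_c n)))%N.
  by move=> cn; rewrite /= dvdn_fact// posnat_gt0.
have [x xP] : exists x, (fun n => cnorm (x_ n - x) : R) @ \oo --> (0 : R).
  apply: cnorm_complete => e e0.
  have e3 : 0 < e / 3 by rewrite divr_gt0.
  have [c cP] := diag_cauchy fc e3; exists (sval c) => m n cm cn.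
  rewrite -(subrKA (wdiag c f)); apply: le_lt_trans (ler_cnormD _ _) _.
  rewrite [X in _ + X]cnormBC; apply: (@le_lt_trans _ _ (e / 3 + e / 3)).
    by rewrite lerD// cP// dvd_c.
  lra.
exists x => e e0; have e3 : 0 < e / 3 by rewrite divr_gt0.
have [c cP] := diag_cauchy fc e3; exists c => d cd.
have /cvgrPdist_lt/(_ _ e3) [N _ NP] := xP.
pose n := maxn N (sval c).
have xn : cnorm (x_ n - x) <= e / 3.
  have := NP n (leq_maxl _ _); rewrite sub0r normrN => H.
  exact: le_trans (ler_norm _) (ltW H).
rewrite -(subrKA (wdiag c f)) -(subrKA (x_ n) (wdiag c f) (- x)).
apply: (le_trans (ler_cnormD _ _)).
have -> : e = e / 3 + (e / 3 + e / 3) by field.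
rewrite lerD ?cP//; apply: (le_trans (ler_cnormD _ _)); rewrite lerD//.
by rewrite cnormBC cP// dvd_c// leq_maxr.
Qed.

Lemma diag_lim1 : diag_lim (fun=> 1) 1.
Proof.
by move=> e e0; exists posnat1 => d _; rewrite wdiag1// subrr cnorm0 ltW.
Qed.

Lemma diag_lim_linear (a : R[i]) f h x y : diag_lim f x -> diag_lim h y ->
  diag_lim (fun i => a * f i + h i) (a *: x + y).
Proof.
move=> fx hy e e0; have a0 : 0 < cabs a + 1 by rewrite ltr_wpDl ?cabs_ge0.
have [c cx] := fx _ (divr_gt0 (divr_gt0 e0 (ltr0n _ 2)) a0).
have [d dy] := hy _ (divr_gt0 e0 (ltr0n _ 2)).
exists (posnatM c d) => n dvd; rewrite wdiag_linear opprD addrACA -scalerBr.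
have -> : e = e / 2 + e / 2 by field.
rewrite (le_trans (ler_cnormD _ _))// lerD//; last first.
  by apply: dy; apply: dvdn_trans dvd; rewrite /= dvdn_mull.
rewrite cnormZ -/(cabs a).
have cn : (sval c %| sval n)%N by apply: dvdn_trans dvd; rewrite /= dvdn_mulr.
apply: (le_trans (ler_wpM2l (cabs_ge0 a) (cx _ cn))).
rewrite mulrCA; apply: ler_piMr; first by rewrite ltW// divr_gt0.
by rewrite ler_pdivrMr// mul1r lerDl.
Qed.

Lemma diag_lim_mul f h x y : diag_lim f x -> diag_lim h y ->
  diag_lim (fun i => f i * h i) (x * y).
Proof.
move=> fx hy e e0.
have y0 : 0 < cnorm y + 1 by rewrite ltr_wpDl ?cnorm_ge0.
have x0 : 0 < cnorm x + 1 by rewrite ltr_wpDl ?cnorm_ge0.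
(* Beyond [b] the sums of [h] are bounded by |y| + 1, the factor that multiplies the error of
   [f]. *)
have [b by1] := hy _ (@ltr01 R).
have [c cx] := fx _ (divr_gt0 (divr_gt0 e0 (ltr0n _ 2)) y0).
have [d dy] := hy _ (divr_gt0 (divr_gt0 e0 (ltr0n _ 2)) x0).
exists (posnatM b (posnatM c d)) => n dvd; rewrite wdiag_mul//.
have bn : (sval b %| sval n)%N by apply: dvdn_trans dvd; rewrite /= dvdn_mulr.
have cn : (sval c %| sval n)%N.
  by apply: dvdn_trans dvd; rewrite /= dvdn_mull// dvdn_mulr.
have dn : (sval d %| sval n)%N.
  by apply: dvdn_trans dvd; rewrite /= dvdn_mull// dvdn_mull.
have -> : wdiag n f * wdiag n h - x * y =
    (wdiag n f - x) * wdiag n h + x * (wdiag n h - y).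
  by rewrite mulrBl mulrBr subrKA.
have -> : e = e / 2 + e / 2 by field.
apply: (le_trans (ler_cnormD _ _)); apply: lerD.
  apply: (le_trans (ler_cnormM _ _)).
  have hb : cnorm (wdiag n h) <= cnorm y + 1.
    by rewrite -(subrKC y (wdiag n h)) (le_trans (ler_cnormD _ _))// lerD2l by1.
  apply: (le_trans (ler_pM (cnorm_ge0 _) (cnorm_ge0 _) (cx _ cn) hb)).
  by rewrite divfK ?gt_eqF.
apply: (le_trans (ler_cnormM _ _)).
have xb : cnorm x <= cnorm x + 1 by rewrite lerDl.
apply: (le_trans (ler_pM (cnorm_ge0 _) (cnorm_ge0 _) xb (dy _ dn))).
by rewrite mulrC divfK ?gt_eqF.
Qed.

Lemma diag_lim_star f x :
  diag_lim f x -> diag_lim (fun i => (f i)^*) (star x).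
Proof.
move=> fx e e0; have [c cx] := fx _ e0; exists c => d cd.
by rewrite wdiag_star// -starB cnorm_star cx.
Qed.

(** Imposed for all admissible pairs of moduli, so that products can be evaluated at a common
    one. *)
Definition implements (g : affQ) (x : A) : Prop :=
  forall c d, affmod g c d ->
    (forall i j, affZ g i j -> x * wiso i c = wiso j d) /\
    (forall i, (forall j, ~ affZ g i j) -> x * wiso i c = 0).

Lemma implements_unique g x y : implements g x -> implements g y -> x = y.
Proof.
move=> gx gy; have [c [d [cd _]]] := affmod_min g.
apply: (@wiso_ext _ _ _ _ rel c) => k.
have [[j kj]|nk] := pselect (exists j, affZ g k%:Z j).
  by rewrite (proj1 (gx _ _ cd) _ _ kj) (proj1 (gy _ _ cd) _ _ kj).
have {}nk j : ~ affZ g k%:Z j by move=> kj; apply: nk; exists j.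
by rewrite (proj2 (gx _ _ cd))// (proj2 (gy _ _ cd)).
Qed.

(** The columns are prescribed at the minimal moduli, with 0 where [g] leaves the integers. Any
    other pair is a multiple by some [e], and [wiso i (posnatM c e) = wiso k c * wiso q e] with i =
    k + c q reduces it to the minimal one. *)
Lemma implements_exists g : exists x, implements g x.
Proof.
have [c [d [cd minP]]] := affmod_min g.
pose t (k : 'I_(sval c)) : A :=
  if pselect (exists j, affZ g k%:Z j) is left ex then wiso (projT1 (cid ex)) d
  else 0.
pose x := \sum_k t k * star (wiso k%:Z c).
have xt (k : 'I_(sval c)) : x * wiso k%:Z c = t k.
  rewrite /x mulr_suml (bigD1 k)//= -mulrA wiso_isometry// mulr1.
  rewrite big1 ?addr0// => l lk; rewrite -mulrA star_wiso_mul0 ?mulr0//.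
  apply: contra lk => /residue_eq; rewrite !residue_id => -[kl].
  by apply/eqP/val_inj.
exists x => c' d' /minP [e [-> ->]].
have wE i : exists (k : 'I_(sval c)) q, i = k%:Z + (sval c)%:Z * q /\
    wiso i (posnatM c e) = wiso k%:Z c * wiso q e.
  have [q iE] := residueE i c; have [k kE] := residue_ord i c.
  by exists k, q; rewrite wisoM// -kE -iE.
split=> i.
  move=> j ij; have [k [q [iE ->]]] := wE i.
  have kj : affZ g k%:Z (j + (sval d)%:Z * - q).
    have := affZ_shift (- q) cd ij.
    by rewrite iE mulrN addrK.
  rewrite mulrA xt /t; case: pselect => [ex|[]]; last by eexists; exact: kj.
  rewrite (affZ_fun (projT2 (cid ex)) kj) wisoM// mulrN -addrA.
  by rewrite [X in _ + X]addrC subrr addr0.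
move=> nij; have [k [q [iE ->]]] := wE i.
rewrite mulrA xt /t; case: pselect => [[j kj]|]; last by rewrite mul0r.
by case: (nij (j + (sval d)%:Z * q)); rewrite iE; apply: affZ_shift.
Qed.

Definition piso (g : affQ) : A := projT1 (cid (implements_exists g)).

Lemma pisoP g : implements g (piso g).
Proof. exact: projT2 (cid (implements_exists g)). Qed.

Lemma pisoE g x : implements g x -> piso g = x.
Proof. exact: implements_unique (@pisoP g). Qed.

Lemma piso_emb (p : affN) : piso (affN_emb p) = wiso p.1%:Z p.2.
Proof.
apply: pisoE => c d cd.
have jE i : affZ (affN_emb p) i (p.1%:Z + (sval p.2)%:Z * i).
  by rewrite /affZ /= intrD intrM.
have dE : posnatM p.2 c = d.
  by apply: posnat_eq; apply/eqP; rewrite -(@eqr_nat rat) cd /= natrM.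
split=> i; last by move=> /(_ _ (jE i)).
by move=> j ij; rewrite wisoM// -(affZ_fun ij (jE i)) dE.
Qed.

Lemma piso1 : piso 1%g = 1.
Proof.
have -> : 1%g = affN_emb (0%N, posnat1).
  by congr (_, _); apply: val_inj.
by rewrite piso_emb wisoE /= expr0 (QN_u1 rel) mul1r.
Qed.

(** Both sides have the same matrix entries between [wiso k c] and [wiso j d]: a power of [s] if [g]
    sends the class of k to that of j, and 0 otherwise. *)
Lemma piso_star g : star (piso g) = piso g^-1%g.
Proof.
symmetry; apply: pisoE => d c /affmodV; rewrite invgK => cd.
have [V1 V0] := pisoP cd.
have [V1' V0'] := pisoP (affmodV cd).
split=> j; last first.
  move=> nji; apply: (@star_wiso_ext _ _ _ _ rel c) => k.
  rewrite mulr0 mulrA -starM.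
  have [[l kl]|nk] := pselect (exists l, affZ g k%:Z l); last first.
    by rewrite V0 ?star0 ?mul0r// => l kl; apply: nk; exists l.
  rewrite (V1 _ _ kl) star_wiso_mul0//; apply/negP => /dvdz_addP[q jE].
  apply: (nji (k%:Z + (sval c)%:Z * q)); apply: affZV.
  by rewrite jE; apply: affZ_shift.
move=> i /affZVK ij; apply: (@star_wiso_ext _ _ _ _ rel c) => k.
rewrite mulrA -starM.
have [[l kl]|nk] := pselect (exists l, affZ g k%:Z l).
  rewrite (V1 _ _ kl).
  have := affZ_dvdz cd kl ij.
  have [/dvdz_addP[q iE]|nki] := boolP ((sval c)%:Z %| i - k%:Z)%Z => dvd.
    have jE : j = l + (sval d)%:Z * q.
      by apply: (affZ_fun ij); rewrite iE; apply: affZ_shift.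
    by rewrite iE jE !star_wiso_mul.
  by rewrite !star_wiso_mul0// -dvd.
rewrite V0 ?star0 ?mul0r => [|l kl]; last by apply: nk; exists l.
rewrite star_wiso_mul0//; apply/negP => /dvdz_addP[q iE]; apply: nk.
exists (j + (sval d)%:Z * - q); have := affZ_shift (- q) cd ij.
by rewrite iE mulrN addrK.
Qed.

(** The left side kills k when h k is not an integer, even if g h k is one; the range projection of
    [piso g] imposes the same condition on the right. *)
Lemma piso_mul (g h : affQ) :
  piso g * piso h = piso g * piso g^-1%g * piso (g * h)%g.
Proof.
have [c [d [e [cd de]]]] := affmod_comp g h.
have ce : affmod (g * h)%g c e.
  by move: cd de; rewrite /affmod /= => -> ->; rewrite mulrA.
apply: (@wiso_ext _ _ _ _ rel c) => k; rewrite -!mulrA.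
have ed := affmodV de.
have no x y : (~ exists l, affZ x y l) -> forall l, ~ affZ x y l.
  by move=> H l xl; apply: H; exists l.
have [[m km]|/no nk] := pselect (exists m, affZ (g * h)%g k%:Z m).
  rewrite (proj1 (pisoP ce) _ _ km).
  have [[l kl]|/no nk] := pselect (exists l, affZ h k%:Z l).
    have lm := affZMl kl km.
    rewrite (proj1 (pisoP cd) _ _ kl) (proj1 (pisoP de) _ _ lm).
    by rewrite (proj1 (pisoP ed) _ _ (affZV lm)) (proj1 (pisoP de) _ _ lm).
  rewrite (proj2 (pisoP cd) _ nk) mulr0 (proj2 (pisoP ed)) ?mulr0// => l /affZVK lm.
  exact: nk (affZMr lm km).
rewrite (proj2 (pisoP ce) _ nk) !mulr0.
have [[l kl]|/no nk'] := pselect (exists l, affZ h k%:Z l).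
  rewrite (proj1 (pisoP cd) _ _ kl) (proj2 (pisoP de))// => m lm.
  exact: nk (affZM kl lm).
by rewrite (proj2 (pisoP cd) _ nk') mulr0.
Qed.

Definition transport (g : affQ) f h : Prop :=
  (forall i j, affZ g i j -> h j = f i) /\
  (forall j, (forall i, ~ affZ g i j) -> h j = 0).

(** Covariance. At a finite modulus it fails only because the representative of a class and the
    preimage of the representative of the image class may differ; both lie in one class modulo [c],
    so continuity of [f] makes the defect small. *)
Lemma piso_diag g f h x y : profinite_continuous f ->
  diag_lim f x -> diag_lim h y -> transport g f h ->
  piso g * x = y * piso g.
Proof.
move=> fc fx hy [hE h0]; apply/eqP; rewrite -subr_eq0; apply/eqP.
set V := piso g.
(* The errors of [x] and [y] contribute 1 each, and the defect [r] contributes 2 through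
   [wdiag_bound]. *)
apply: (@cnorm_eps_eq0 _ _ _ (4 * cnorm V)) => e e0.
have [c0 [d0 [cd0 _]]] := affmod_min g.
have [a aP] := fc _ e0.
have [b bP] := fx _ e0; have [b' b'P] := hy _ e0.
pose n := posnatM a (posnatM b b').
pose c := posnatM c0 n; pose d := posnatM d0 n.
have cd : affmod g c d by exact: affmodMr.
have dvd_n m : (sval m %| sval n)%N -> (sval m %| sval c)%N /\ (sval m %| sval d)%N.
  by move=> mn; split; rewrite /= dvdn_mull.
have [ac _] : (sval a %| sval c)%N /\ (sval a %| sval d)%N.
  by apply: dvd_n; rewrite /= dvdn_mulr.
have [bc _] : (sval b %| sval c)%N /\ (sval b %| sval d)%N.
  by apply: dvd_n; rewrite /= dvdn_mull// dvdn_mulr.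
have [_ b'd] : (sval b' %| sval c)%N /\ (sval b' %| sval d)%N.
  by apply: dvd_n; rewrite /= dvdn_mull// dvdn_mull.
have [V1 V0] := pisoP cd; rewrite -/V in V1 V0.
(* The defect as a diagonal function on the target side; off the range of [g] its value is
   immaterial to the product with [V], and 0 keeps it bounded. *)
pose r j : R[i] := if pselect (exists i, affZ g i j) is left ex then
  let i := projT1 (cid ex) in f (residue i c) - f i else 0.
have rE i j : affZ g i j -> r j = f (residue i c) - f i.
  move=> ij; rewrite /r; case: pselect => [ex|[]]; last by exists i.
  by have /= -> := affZ_fun (affZV (projT2 (cid ex))) (affZV ij).
have diff : V * wdiag c f - wdiag d h * V = wdiag d r * V.
  apply: (@wiso_ext _ _ _ _ rel c) => k.
  rewrite mulrBl -!mulrA wdiag_ord// -scalerAr.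
  have [[j kj]|nk] := pselect (exists j, affZ g k%:Z j); last first.
    by rewrite V0 ?mulr0 ?scaler0 ?subr0// => j kj; apply: nk; exists j.
  rewrite (V1 _ _ kj) !wdiag_wiso// -scalerBl; congr (_ *: _).
  have [q jE] := residueE j d.
  have kj' : affZ g (k%:Z - (sval c)%:Z * q) (residue j d).
    have := affZ_shift (- q) cd kj.
    by rewrite !mulrN {1}jE addrK.
  rewrite (hE _ _ kj') (rE _ _ kj'); congr (_ - _); congr f.
  rewrite -[LHS]residue_id; apply: residue_eq.
  by rewrite opprB addrCA subrr addr0 dvdz_mulr.
have rb : cnorm (wdiag d r) <= 2 * e.
  apply: (wdiag_bound rel) => // k; rewrite /r; case: pselect => [ex|_].
    apply: aP; apply: dvdz_trans (dvdz_residue _ c); exact: ac.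
  by rewrite cabs0 ltW.
have -> : V * x - y * V = V * (x - wdiag c f) +
    (V * wdiag c f - wdiag d h * V) + (wdiag d h - y) * V.
  by rewrite mulrBr mulrBl subrKA subrKA.
rewrite diff.
have -> : 4 * cnorm V * e = cnorm V * e + 2 * e * cnorm V + e * cnorm V by ring.
apply: (le_trans (ler_cnormD _ _)); apply: lerD.
  apply: (le_trans (ler_cnormD _ _)); apply: lerD.
    apply: (le_trans (ler_cnormM _ _)); rewrite ler_wpM2l ?cnorm_ge0//.
    by rewrite cnormBC bP.
  by apply: (le_trans (ler_cnormM _ _)); rewrite ler_wpM2r ?cnorm_ge0.
apply: (le_trans (ler_cnormM _ _)); rewrite ler_wpM2r ?cnorm_ge0//.
exact: b'P.
Qed.

(** [piso g * piso g^-1] is 1 on the classes met by the range of [g], outside which [h] vanishes.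
    This removes the projection that [piso_mul] introduces. *)
Lemma diag_piso_range g h y : diag_lim h y ->
  (forall j, (forall i, ~ affZ g i j) -> h j = 0) ->
  y * (piso g * piso g^-1%g) = y.
Proof.
move=> hy h0; apply/eqP; rewrite -subr_eq0; apply/eqP.
set P := piso g * piso g^-1%g.
apply: (@cnorm_eps_eq0 _ _ _ (cnorm P + 1)) => e e0.
have [c0 [d0 [cd0 _]]] := affmod_min g.
have [b bP] := hy _ e0.
pose c := posnatM c0 b; pose d := posnatM d0 b.
have cd : affmod g c d by exact: affmodMr.
have bd : cnorm (wdiag d h - y) <= e by apply: bP; rewrite /= dvdn_mull.
have dP : wdiag d h * P = wdiag d h.
  apply: (@wiso_ext _ _ _ _ rel d) => k; rewrite /P -!mulrA.
  have [[i ki]|nk] := pselect (exists i, affZ g^-1%g k%:Z i).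
    rewrite (proj1 (pisoP (affmodV cd)) _ _ ki).
    by rewrite (proj1 (pisoP cd) _ _ (affZVK ki)).
  rewrite (proj2 (pisoP (affmodV cd))) => [|i ki]; last by apply: nk; exists i.
  rewrite !mulr0 wdiag_ord// h0 ?scale0r// => i /affZV ik.
  by apply: nk; exists i.
have -> : y * P - y = (y - wdiag d h) * P + (wdiag d h - y).
  by rewrite mulrBl dP subrKA.
have -> : (cnorm P + 1) * e = e * cnorm P + e by ring.
apply: (le_trans (ler_cnormD _ _)); rewrite lerD//.
apply: (le_trans (ler_cnormM _ _)); rewrite ler_wpM2r ?cnorm_ge0//.
by rewrite cnormBC.
Qed.

End QNDiagonalLimit.

(** * The boundary of the Nica spectrum *)

Section AffineOrder.
Implicit Types (x y z p q : affN) (g h : affQ).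

Lemma affN_emb_inj : injective affN_emb.
Proof.
move=> [m a] [n b] [/eqP + ab]; rewrite eqr_nat => /eqP <-; congr (_, _).
by apply: posnat_eq; apply/eqP; rewrite -(@eqr_nat rat) ab.
Qed.

Lemma affN_leP x y :
  affQ_le (affN_emb x) (affN_emb y) <-> exists p, y = affNM x p.
Proof.
split=> [[p E]|[p ->]]; exists p; last by rewrite affN_embM mulKg.
by apply: affN_emb_inj; rewrite affN_embM -E mulVKg.
Qed.

Lemma affQ_le_refl g : affQ_le g g.
Proof. by exists (0%N, posnat1); rewrite mulVg; congr (_, _); apply: val_inj. Qed.

Lemma affQ_le_trans g h k : affQ_le g h -> affQ_le h k -> affQ_le g k.
Proof.
move=> [p gh] [q hk]; exists (affNM p q).
by rewrite affN_embM -gh -hk -mulgA mulVKg.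
Qed.

Lemma affQ_le_mul2l g h k : affQ_le (k * g)%g (k * h)%g <-> affQ_le g h.
Proof.
have E : ((k * g)^-1 * (k * h) = g^-1 * h)%g by rewrite invgM -mulgA mulKg.
by rewrite /affQ_le E.
Qed.

Lemma affN_le_res x y : affQ_le (affN_emb x) (affN_emb y) ->
  (sval x.2 %| sval y.2)%N /\ ((sval x.2)%:Z %| y.1%:Z - x.1%:Z)%Z.
Proof.
move=> /affN_leP[p ->] /=; split; first by rewrite dvdn_mulr.
by rewrite PoszD addrC addKr PoszM dvdz_mulr.
Qed.

Lemma affN_le_intro x y : (x.1 <= y.1)%N -> (sval x.2 %| sval y.2)%N ->
  ((sval x.2)%:Z %| y.1%:Z - x.1%:Z)%Z -> affQ_le (affN_emb x) (affN_emb y).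
Proof.
move=> xy /dvdnP[e yE]; rewrite subzn// => /dvdnP[n /= nE].
have e0 : (0 < e)%N by move: (posnat_gt0 y.2); rewrite yE muln_gt0 => /andP[].
apply/affN_leP; exists (n, mkpos e0).
case: x y xy yE nE => [m a] [m' b] /= xy yE nE; congr (_, _).
  by rewrite mulnC -nE subnKC.
by apply: posnat_eq; rewrite /= yE mulnC.
Qed.

End AffineOrder.

Section Boundary.
Implicit Types (w v : cubeP) (c : posnat).

Lemma dvdz_subC (a x y : int) : (a %| x - y)%Z = (a %| y - x)%Z.
Proof. by rewrite -opprB rpredN. Qed.

Lemma dvdz_sub_trans (a x y z : int) :
  (a %| x - y)%Z -> (a %| y - z)%Z -> (a %| x - z)%Z.
Proof. by move=> xy yz; rewrite -(subrKA y) rpredD. Qed.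

Definition residue_at w c (k : int) : Prop :=
  forall m : nat, w (m, c) = ((sval c)%:Z %| m%:Z - k)%Z.

Definition same_residue c w v : Prop := forall m : nat, w (m, c) = v (m, c).

Definition int_point (i : int) : cubeP :=
  fun p => ((sval p.2)%:Z %| p.1%:Z - i)%Z.

Lemma directed_upper_bound w (l : seq affN) : nica_spectrum w -> all w l ->
  exists2 z, w z & forall x, x \in l -> affQ_le (affN_emb x) (affN_emb z).
Proof.
move=> [[x0 wx0] _ wdir]; elim: l => [|x l IHl]; first by exists x0.
move=> /= /andP[wx /IHl [z wz lz]]; have [y [wy xy zy]] := wdir _ _ wx wz.
exists y => // t; rewrite inE => /orP[/eqP ->//|/lz tz].
exact: affQ_le_trans tz zy.
Qed.

(** Besides congruences, the order on the semigroup compares first components; a large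
    representative of the class takes care of that. *)
Lemma nat_residue (i : int) c (N : nat) :
  exists2 n : nat, (N <= n)%N & ((sval c)%:Z %| n%:Z - i)%Z.
Proof.
have h0 : 0 <= residue i c by rewrite modz_ge0 ?posnatZ_neq0.
exists (absz (residue i c) + sval c * N)%N.
  by rewrite (leq_trans _ (leq_addl _ _))// leq_pmull// posnat_gt0.
rewrite PoszD gez0_abs// PoszM addrAC rpredD ?dvdz_mulr//.
exact: dvdz_residue.
Qed.

Lemma dvdz_gcd_crt (a b : posnat) (k n : int) :
  ((gcdn (sval a) (sval b))%:Z %| n - k)%Z ->
  exists z, ((sval a)%:Z %| z - k)%Z /\ ((sval b)%:Z %| z - n)%Z.
Proof.
move=> /dvdzP[t nk].
have [v1 [v2 vE]] := Bezoutz (sval a)%:Z (sval b)%:Z.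
exists (k + t * v1 * (sval a)%:Z); split; first by rewrite addrC addKr dvdz_mull.
have -> : k + t * v1 * (sval a)%:Z - n = - (t * v2) * (sval b)%:Z.
  have gE : (gcdn (sval a) (sval b))%:Z = v1 * (sval a)%:Z + v2 * (sval b)%:Z.
    by rewrite vE.
  have -> : n = k + t * (v1 * (sval a)%:Z + v2 * (sval b)%:Z).
    by rewrite -gE -nk subrKC.
  ring.
by rewrite dvdz_mull.
Qed.

Definition lcmpos (a b : posnat) : posnat :=
  exist (fun n : nat => 0 < n)%N (lcmn (sval a) (sval b))
    (etrans (lcmn_gt0 _ _) (introT andP (conj (svalP a) (svalP b)))).

Lemma dvdz_lcm (a b : posnat) (x : int) :
  ((sval (lcmpos a b))%:Z %| x)%Z =
  ((sval a)%:Z %| x)%Z && ((sval b)%:Z %| x)%Z.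
Proof. by rewrite !dvdzE /= dvdn_lcm. Qed.

(** Some class modulo [a] is compatible with all congruences recorded in [w]; adjoining it gives a
    larger element of the spectrum, which by maximality is [w] itself. *)
Lemma maximal_residue w : maximal_spectrum w -> forall a, exists k, residue_at w a k.
Proof.
move=> [wn wmax] a; have [[x0 wx0] whered wdir] := wn.
(* If every k < a were refuted by an element of [w], an upper bound of these finitely many elements
   would still have a residue modulo [a], and that residue is not refuted. *)
have [k kP] : exists k : int, forall x, w x ->
    ((gcdn (sval a) (sval x.2))%:Z %| x.1%:Z - k)%Z.
  apply: contrapT => nk.
  have bad (k : 'I_(sval a)) : exists x, w x /\
      ~~ ((gcdn (sval a) (sval x.2))%:Z %| x.1%:Z - k%:Z)%Z.
    apply: contrapT => nx; apply: nk; exists k%:Z => x wx.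
    by apply: contrapT => /negP h; apply: nx; exists x.
  pose f k := projT1 (cid (bad k)).
  have fP k : w (f k) /\
      ~~ ((gcdn (sval a) (sval (f k).2))%:Z %| (f k).1%:Z - k%:Z)%Z.
    exact: projT2 (cid (bad k)).
  have wf : all w [seq f k | k <- enum 'I_(sval a)].
    by apply/allP => _ /mapP[k _ ->]; exact: (fP k).1.
  have [z wz zP] := directed_upper_bound wn wf.
  have [k kE] := residue_ord z.1%:Z a.
  have /affN_le_res [fz2 fz1] : affQ_le (affN_emb (f k)) (affN_emb z).
    by apply: zP; apply: map_f; rewrite mem_enum.
  have [_ /negP] := fP k; apply.
  rewrite dvdz_subC; apply: (@dvdz_sub_trans _ _ z.1%:Z).
    rewrite -kE; apply: dvdz_trans (dvdz_residue _ a).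
    by rewrite dvdzE /= dvdn_gcdl.
  by apply: dvdz_trans fz1; rewrite dvdzE /= dvdn_gcdr.
(* All elements whose congruence follows from that of some x in [w] together with k modulo [a]; z is
   a common solution of the two. *)
pose D (y : affN) := exists x (z : int), [/\ w x,
  ((sval x.2)%:Z %| z - x.1%:Z)%Z, ((sval a)%:Z %| z - k)%Z,
  (sval y.2 %| sval (lcmpos a x.2))%N & ((sval y.2)%:Z %| y.1%:Z - z)%Z].
pose v : cubeP := fun y => `[< D y >].
have vE y : v y <-> D y by split=> [/asboolP|?]; last exact/asboolP.
have crt x : w x -> exists z : int,
    ((sval x.2)%:Z %| z - x.1%:Z)%Z /\ ((sval a)%:Z %| z - k)%Z.
  by move=> /kP /dvdz_gcd_crt [z [za zx]]; exists z.
have wv x : w x -> v x.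
  move=> wx; apply/vE; have [z [zx za]] := crt _ wx; exists x, z.
  by split; rewrite //= ?dvdn_lcmr// dvdz_subC.
have vn : nica_spectrum v.
  split; first by exists x0; exact: wv.
    move=> x y /affN_le_res[xy2 xy1] /vE[t [z [wt zt za yt yz]]]; apply/vE.
    exists t, z; split=> //; first exact: dvdn_trans yt.
    rewrite dvdz_subC in xy1; apply: dvdz_sub_trans xy1 _.
    by apply: dvdz_trans yz; rewrite dvdzE.
  move=> y y' /vE[x [z [wx zx za yx yz]]] /vE[x' [z' [wx' zx' za' yx' yz']]].
  have [t [wt /affN_le_res[xt2 xt1] /affN_le_res[xt2' xt1']]] := wdir _ _ wx wx'.
  have [r [rt ra]] := crt _ wt.
  have [n nN nr] := nat_residue r (lcmpos a t.2) (y.1 + y'.1)%N.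
  move: (nr); rewrite dvdz_lcm => /andP[nra nrt].
  have key p q (i : int) : (sval p.2 %| sval t.2)%N ->
      ((sval p.2)%:Z %| t.1%:Z - p.1%:Z)%Z ->
      ((sval p.2)%:Z %| i - p.1%:Z)%Z -> ((sval a)%:Z %| i - k)%Z ->
      (sval q.2 %| sval (lcmpos a p.2))%N -> ((sval q.2)%:Z %| q.1%:Z - i)%Z ->
      (q.1 <= n)%N -> affQ_le (affN_emb q) (affN_emb (n, lcmpos a t.2)).
    move=> pt pt1 ip ia qp qi qn; apply: affN_le_intro => //=.
      apply: (dvdn_trans qp); rewrite /= dvdn_lcm dvdn_lcml /=.
      exact: dvdn_trans pt (dvdn_lcmr _ _).
    rewrite dvdz_subC; apply: (dvdz_sub_trans qi).
    apply: (@dvdz_trans (sval (lcmpos a p.2))%:Z); first by rewrite dvdzE.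
    rewrite dvdz_lcm; apply/andP; split.
      apply: (dvdz_sub_trans ia); rewrite dvdz_subC.
      exact: dvdz_sub_trans nra ra.
    apply: (dvdz_sub_trans ip); rewrite dvdz_subC.
    apply: dvdz_sub_trans pt1.
    by apply: dvdz_trans (dvdz_sub_trans nrt rt); rewrite dvdzE.
  exists (n, lcmpos a t.2); split.
  - by apply/vE; exists t, r; split.
  - by apply: key xt2 xt1 zx za yx yz _; apply: leq_trans nN; rewrite leq_addr.
  - by apply: key xt2' xt1' zx' za' yx' yz' _; apply: leq_trans nN; rewrite leq_addl.
have <- := wmax _ vn wv.
exists k => m; apply/idP/idP => [/vE[x [z [_ _ za _ mz]]]|mk].
  exact: dvdz_sub_trans mz za.
apply/vE; have [z [zx za]] := crt _ wx0; exists x0, z; split=> //=.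
  exact: dvdn_lcml.
by apply: dvdz_sub_trans mk _; rewrite dvdz_subC.
Qed.

Lemma int_point_nica i : nica_spectrum (int_point i).
Proof.
split.
- by exists (0%N, posnat1); rewrite /int_point /= dvdzE dvd1n.
- move=> x y /affN_le_res[xy2 xy1] /= yi.
  rewrite dvdz_subC in xy1; apply: dvdz_sub_trans xy1 _.
  by apply: dvdz_trans yi; rewrite dvdzE.
- move=> x y xi yi.
  have [n nN ni] := nat_residue i (lcmpos x.2 y.2) (x.1 + y.1)%N.
  move: (ni); rewrite dvdz_lcm => /andP[nx ny].
  exists (n, lcmpos x.2 y.2); split=> //; apply: affN_le_intro => /=.
  + by apply: leq_trans nN; rewrite leq_addr.
  + exact: dvdn_lcml.
  + by apply: (dvdz_sub_trans nx); rewrite dvdz_subC.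
  + by apply: leq_trans nN; rewrite leq_addl.
  + exact: dvdn_lcmr.
  + by apply: (dvdz_sub_trans ny); rewrite dvdz_subC.
Qed.

Lemma nica_congruent w (m n : nat) c : nica_spectrum w ->
  w (m, c) -> w (n, c) -> ((sval c)%:Z %| m%:Z - n%:Z)%Z.
Proof.
move=> [_ _ wdir] wm wn.
have [z [_ /affN_le_res[_ /= mz] /affN_le_res[_ /= nz]]] := wdir _ _ wm wn.
by apply: dvdz_sub_trans nz; rewrite dvdz_subC.
Qed.

(** An element of the spectrum holds at most one class at each level [c], and [int_point i] already
    fills one. *)
Lemma int_point_maximal i : maximal_spectrum (int_point i).
Proof.
split=> [|v vn iv]; first exact: int_point_nica.
apply/funext => -[m c]; apply/idP/idP; last exact: iv.
move=> vm; have [n _ ni] := nat_residue i c 0.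
have := nica_congruent vn vm (iv (n, c) ni) => mn.
exact: dvdz_sub_trans mn ni.
Qed.

Lemma nbhs_cylinder w (l : seq affN) :
  nbhs w [set v : cubeP | all (fun p => v p == w p) l].
Proof.
elim: l => [|p l IHl]; first by apply: filterS filterT.
have cp : nbhs w [set v : cubeP | v p == w p].
  have := @proj_continuous affN (fun _ => bool) p w.
  move=> /(_ [set b | b == w p]) H; apply: H.
  by move=> b /= ->.
by apply: filterS (filterI cp IHl) => v /= [-> ->].
Qed.

Lemma nbhs_cylinderP w (U : set cubeP) : nbhs w U ->
  exists l : seq affN, [set v : cubeP | all (fun p => v p == w p) l] `<=` U.
Proof.
(* For the product topology, convergence of the filter generated by the cylinders can be checked one
   coordinate at a time. *)
pose G : set_system cubeP := [set B | exists l : seq affN,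
  [set v : cubeP | all (fun p => v p == w p) l] `<=` B].
have GF : Filter G.
  split; first by exists [::].
    move=> B C [l lB] [l' l'C]; exists (l ++ l') => v /=.
    by rewrite all_cat => /andP[/lB Bv /l'C Cv].
  by move=> B C BC [l lB]; exists l; exact: subset_trans BC.
suff : G --> w by exact.
apply/cvg_sup => p B.
rewrite (@nbhsE (initial_topology (fun f : cubeP => f p))) => -[_ [[C oC <-] /= Cw] CB].
by exists [:: p] => v /=; rewrite andbT => /eqP vw; apply: CB; rewrite /= /proj vw.
Qed.

Lemma closure_agree (S : set cubeP) w (l : seq affN) : closure S w ->
  exists2 v, S v & forall p, p \in l -> v p = w p.
Proof.
move=> /(_ _ (nbhs_cylinder w l)) [v [Sv /allP lv]].
by exists v => // p /lv /eqP.
Qed.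

(** The assertion concerns infinitely many coordinates. Agreement on (0, c), ..., (c - 1, c) first
    finds the residue; each further m is then settled by its own approximation at m and that
    residue. *)
Lemma closure_residue w : closure maximal_spectrum w ->
  forall c, exists k, residue_at w c k.
Proof.
move=> wc c.
have [v vm vw] :=
  closure_agree [seq (k, c) | k <- iota 0 (sval c)] wc.
have [k vk] := maximal_residue vm c.
have [r rE] := residue_ord k c.
have wr : w (val r, c).
  rewrite -vw; last by apply: map_f; rewrite mem_iota /= add0n ltn_ord.
  by rewrite vk -rE dvdz_residue.
exists r%:Z => m.
have [v' v'm v'w] := closure_agree [:: (m, c); (val r, c)] wc.
rewrite -v'w ?mem_head//.
have [k' v'k] := maximal_residue v'm c.
have := v'w (val r, c); rewrite !inE eqxx orbT wr => /(_ isT).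
rewrite !v'k => rk'; apply/idP/idP => mk.
  by apply: (dvdz_sub_trans mk); rewrite dvdz_subC.
exact: dvdz_sub_trans mk rk'.
Qed.

(** The closure already lies in the spectrum, which makes the boundary compact. For directedness,
    the upper bound is fixed at the level of the least common multiple before a maximal element is
    chosen that agrees on the three points. *)
Lemma boundaryE : nica_boundary = closure maximal_spectrum.
Proof.
apply/seteqP; split=> [w []//|w wc]; split=> //.
have res := closure_residue wc.
have [k wk] := res posnat1.
split; first by exists (0%N, posnat1); rewrite wk dvdzE dvd1n.
  move=> x y xy wy; have [v [[_ vh _] _] vw] := closure_agree [:: x; y] wc.
  rewrite -vw ?mem_head//; apply: vh xy _.
  by rewrite vw ?wy// !inE eqxx orbT.
move=> x y wx wy; pose c := lcmpos x.2 y.2.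
have [i wi] := res c; have [n nN ni] := nat_residue i c (x.1 + y.1)%N.
have wn : w (n, c) by rewrite wi.
have [v [[_ vh vd] _] vw] := closure_agree [:: x; y; (n, c)] wc.
have vn : v (n, c) by rewrite vw ?wn// !inE eqxx !orbT.
have key z : v z -> (sval z.2 %| sval c)%N -> (z.1 <= n)%N ->
    affQ_le (affN_emb z) (affN_emb (n, c)).
  move=> vz zc zn; apply: affN_le_intro => //=.
  have [t [_ /affN_le_res[_ zt] /affN_le_res[_ nt]]] := vd _ _ vz vn.
  rewrite dvdz_subC; rewrite dvdz_subC in zt.
  apply: (dvdz_sub_trans zt); apply: dvdz_trans nt; by rewrite dvdzE.
exists (n, c); split=> //; apply: key.
- by rewrite vw ?wx// mem_head.
- exact: dvdn_lcml.
- by apply: leq_trans nN; rewrite leq_addr.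
- by rewrite vw ?wy// !inE eqxx !orbT.
- exact: dvdn_lcmr.
- by apply: leq_trans nN; rewrite leq_addl.
Qed.

Lemma boundary_nica w : nica_boundary w -> nica_spectrum w.
Proof. by case. Qed.

Lemma int_point_boundary i : nica_boundary (int_point i).
Proof. by rewrite boundaryE; apply: subset_closure; exact: int_point_maximal. Qed.

Lemma boundary_residue w : nica_boundary w -> forall c, exists k, residue_at w c k.
Proof. by case=> /closure_residue. Qed.

Lemma boundary_compact : compact nica_boundary.
Proof.
have cT : compact [set: cubeP].
  have := @tychonoff affN (fun _ => bool) (fun _ => setT) (fun _ => bool_compact).
  by congr compact; apply/seteqP; split.
apply: (@subclosed_compact _ nica_boundary _ _ cT) => //.
by rewrite boundaryE; exact: closed_closure.
Qed.

Lemma same_residueS b c w v : nica_boundary w -> nica_boundary v ->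
  (sval b %| sval c)%N -> same_residue c w v -> same_residue b w v.
Proof.
move=> wX vX bc wv m.
have [k wk] := boundary_residue wX b; have [l vl] := boundary_residue vX b.
have [i wi] := boundary_residue wX c.
have [n _ ni] := nat_residue i c 0.
have nc : affQ_le (affN_emb (n, b)) (affN_emb (n, c)).
  by apply: affN_le_intro => //=; rewrite subrr dvdz0.
have wn : w (n, c) by rewrite wi.
have vn : v (n, c) by rewrite -wv.
have [_ wh _] := boundary_nica wX; have [_ vh _] := boundary_nica vX.
have := wh _ _ nc wn; have := vh _ _ nc vn; rewrite wk vl wk vl => nl nk.
apply/idP/idP => [mk|ml].
  by apply: dvdz_sub_trans nl; apply: (dvdz_sub_trans mk); rewrite dvdz_subC.
by apply: dvdz_sub_trans nk; apply: (dvdz_sub_trans ml); rewrite dvdz_subC.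
Qed.

End Boundary.

(** * Continuity on the boundary as uniformity in residues *)

Section BoundaryFunctions.
Variable R : realType.
Implicit Types (f : cubeP -> R[i]) (c : posnat).

(** Uniform continuity on a compact space, with the partitions into residue classes as
    entourages. *)
Lemma boundary_continuousP f :
  {within nica_boundary, continuous (f : cubeP -> R[i]^o)} <->
  (forall e : R, 0 < e -> exists c, forall w v,
     nica_boundary w -> nica_boundary v -> same_residue c w v ->
     cabs (f w - f v) <= e).
Proof.
rewrite subspace_continuousP; split=> [fc e e0|fc w wX].
  have e2 : 0 < e / 2 by rewrite divr_gt0.
  apply: contrapT => nc.
  (* If no modulus works, these sets decrease along divisibility and generate a filter, which
     clusters at a boundary point; continuity there gives the contradiction. *)
  pose bad c : set cubeP := [set w | nica_boundary w /\ exists v,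
    [/\ nica_boundary v, same_residue c w v & ~ cabs (f w - f v) <= e]].
  have bad0 c : bad c !=set0.
    apply: contrapT => nbad; apply: nc; exists c => w v wX vX wv.
    by apply: contrapT => fwv; apply: nbad; exists w; split=> //; exists v.
  have badS b c : (sval b %| sval c)%N -> bad c `<=` bad b.
    move=> bc w [wX [v [vX wv fwv]]]; split=> //; exists v; split=> //.
    exact: same_residueS bc wv.
  pose F : set_system cubeP := [set B | exists c, bad c `<=` B].
  have FF : ProperFilter F.
    split; first by move=> [c bc0]; have [w /bc0] := bad0 c.
    split; first by exists posnat1.
      move=> B C [b bB] [c cC]; exists (posnatM b c) => w bw; split.
        by apply: bB; apply: badS bw; rewrite dvdn_mulr.
      by apply: cC; apply: badS bw; rewrite dvdn_mull.
    by move=> B C BC [c cB]; exists c; exact: subset_trans BC.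
  have FX : F nica_boundary by exists posnat1 => w [].
  have [w [wX wcl]] := boundary_compact FF FX.
  have /cvgrPdist_le/(_ (e / 2)%:C%C) := fc _ wX.
  rewrite -(ltcR 0) in e2; move=> /(_ e2).
  rewrite nearE /within /= => /nbhs_cylinderP [l lP].
  have close v : nica_boundary v -> (forall p, p \in l -> v p = w p) ->
      cabs (f w - f v) <= e / 2.
    move=> vX vw; rewrite -(@lecR R) cabsC; apply: lP => //=.
    by apply/allP => p pl; rewrite vw.
  have [c cP] : exists c, forall p, p \in l -> (sval p.2 %| sval c)%N.
    elim: (l) => [|p l' [c cP]]; first by exists posnat1.
    exists (posnatM p.2 c) => q; rewrite inE => /orP[/eqP ->|/cP qc] /=.
      by rewrite dvdn_mulr.
    by rewrite dvdn_mull.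
  have Fc : F (bad c) by exists c.
  have [v [[vX [v' [v'X vv' fvv']]] /allP vw]] := wcl _ _ Fc (nbhs_cylinder w l).
  apply: fvv'; rewrite -(subrKA (f w)) (le_trans (cabsD _ _))//.
  rewrite [e]splitr; apply: lerD; last first.
    apply: close => // p pl; rewrite -(eqP (vw _ pl)).
    have := same_residueS vX v'X (cP _ pl) vv' p.1.
    by case: (p) => ? ? /= ->.
  rewrite -cabsN opprB; apply: close => // p pl; exact/eqP/vw.
apply/cvgrPdist_le => e e0.
have eE : e = (complex.Re e)%:C%C by rewrite RRe_real// gtr0_real.
have re0 : 0 < complex.Re e by rewrite -(@ltcR R) -eE.
have [c cP] := fc _ re0.
have [k wk] := boundary_residue wX c; have [n _ nk] := nat_residue k c 0.
rewrite nearE /within /=; apply: filterS (nbhs_cylinder w [:: (n, c)]) => v /=.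
rewrite andbT => /eqP vn vX; rewrite eE -cabsC lecR; apply: cP => // m.
have [l vl] := boundary_residue vX c.
move: vn; rewrite wk vl nk => nl; rewrite wk vl; apply/idP/idP => [mk|ml].
  by apply: dvdz_sub_trans nl; apply: (dvdz_sub_trans mk); rewrite dvdz_subC.
by apply: dvdz_sub_trans nk; apply: (dvdz_sub_trans ml); rewrite dvdz_subC.
Qed.

End BoundaryFunctions.

(** * Covariant representations over the boundary *)

Section NicaAction.
Implicit Types (w : cubeP) (p q : affN) (g : affQ).

Lemma hull_emb w p : nica_spectrum w -> hull w (affN_emb p) <-> w p.
Proof.
move=> [_ wh _]; split=> [[x wx px]|wp]; first exact: wh px wx.
by exists p => //; exact: affQ_le_refl.
Qed.

Lemma hull_embV w p : nica_spectrum w -> hull w (affN_emb p)^-1%g.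
Proof.
move=> [[x wx] _ _]; exists x => //; exists (affNM p x).
by rewrite invgK affN_embM.
Qed.

Lemma hull1 w : nica_spectrum w -> hull w 1%g.
Proof.
move=> /(hull_embV (0%N, posnat1)); congr hull.
by rewrite -invg1; congr (_^-1)%g; congr (_, _); apply: val_inj.
Qed.

Lemma thetaP g w q : theta g w q <-> hull w (g^-1 * affN_emb q)%g.
Proof.
split=> [/asboolP[h wh ->]|wh]; first by rewrite mulKg.
by apply/asboolP; exists (g^-1 * affN_emb q)%g; rewrite ?mulVKg.
Qed.

Lemma theta1 w : nica_spectrum w -> theta 1%g w = w.
Proof.
move=> wn; apply/funext => q; apply/idP/idP => [/thetaP|wq].
  by rewrite invg1 mul1g hull_emb.
by apply/thetaP; rewrite invg1 mul1g hull_emb.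
Qed.

Lemma theta_emb_self w p : nica_spectrum w -> theta (affN_emb p) w p.
Proof. by move=> wn; apply/thetaP; rewrite mulVg; exact: hull1. Qed.

Lemma theta_embV w p q : nica_spectrum w ->
  theta (affN_emb p)^-1%g w q = w (affNM p q).
Proof.
move=> wn; apply/idP/idP => [/thetaP|wpq].
  by rewrite invgK -affN_embM hull_emb.
by apply/thetaP; rewrite invgK -affN_embM hull_emb.
Qed.

Lemma theta_embV_nica w p : nica_spectrum w -> w p ->
  nica_spectrum (theta (affN_emb p)^-1%g w).
Proof.
move=> wn wp; have [_ wh wd] := wn; split.
- exists (0%N, posnat1); rewrite theta_embV// (_ : affNM _ _ = p)//.
  case: p wp => m a wp; congr (_, _); first by rewrite /= muln0 addn0.
  by apply: posnat_eq; rewrite /= muln1.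
- move=> x y xy; rewrite !theta_embV//; apply: wh.
  by rewrite !affN_embM affQ_le_mul2l.
- move=> x y; rewrite !theta_embV// => wx wy.
  have [z [wz xz yz]] := wd _ _ wx wy.
  have /affN_leP[t zE] : affQ_le (affN_emb p) (affN_emb z).
    by apply: affQ_le_trans xz; apply/affN_leP; exists x.
  exists t; rewrite theta_embV// -zE; split=> //.
    by rewrite -(affQ_le_mul2l _ _ (affN_emb p)) -!affN_embM -zE.
  by rewrite -(affQ_le_mul2l _ _ (affN_emb p)) -!affN_embM -zE.
Qed.

Lemma theta_embK w p : nica_spectrum w -> w p ->
  theta (affN_emb p) (theta (affN_emb p)^-1%g w) = w.
Proof.
move=> wn wp; have [_ wh wd] := wn.
apply/funext => y; apply/idP/idP => [/thetaP[x]|wy].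
  rewrite theta_embV// => wpx yx; apply: wh wpx.
  by rewrite affN_embM -(affQ_le_mul2l _ _ (affN_emb p)^-1%g) mulKg.
have [z [wz pz yz]] := wd _ _ wp wy.
move/affN_leP: pz => [t zE]; apply/thetaP; exists t.
  by rewrite theta_embV// -zE.
by rewrite -(affQ_le_mul2l _ _ (affN_emb p)) mulVKg -affN_embM -zE.
Qed.

(** Hence the indicator that represents w_p in the crossed product over the spectrum is
    [cylinder p]. *)
Lemma theta_emb_image w p : nica_spectrum w ->
  (theta (affN_emb p) @` nica_spectrum) w <-> w p.
Proof.
move=> wn; split=> [[v vn <-]|wp]; first exact: theta_emb_self.
exists (theta (affN_emb p)^-1%g w); first exact: theta_embV_nica.
exact: theta_embK.
Qed.

End NicaAction.

(** Moving i and k along their classes by a common large multiple makes both nonnegative and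
    exhibits [g] as a quotient of semigroup elements. *)
Lemma affZ_quotient (g : affQ) (b c : posnat) (i k : int) :
  affmod g b c -> affZ g i k -> exists p q,
    [/\ g = (affN_emb p * (affN_emb q)^-1)%g, p.2 = c &
        ((sval c)%:Z %| p.1%:Z - k)%Z].
Proof.
move=> bc ik; pose N := (absz i + absz k)%N.
pose j := i + (sval b)%:Z * N%:Z; pose l := k + (sval c)%:Z * N%:Z.
have jl : affZ g j l by exact: affZ_shift.
have j0 : 0 <= j by rewrite /j /N; have := posnat_gt0 b; nia.
have l0 : 0 <= l by rewrite /l /N; have := posnat_gt0 c; nia.
have lk : ((sval c)%:Z %| l - k)%Z by rewrite /l addrC addKr dvdz_mulr.
clearbody j l; exists (absz l, c), (absz j, b); split => //.
  apply/(canRL (mulgK _)); congr (_, _); last by apply: val_inj; rewrite /= bc.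
  by rewrite /= !pmulrn !gez0_abs// -jl.
by rewrite /= gez0_abs.
Qed.

(** Gives the uniform continuity of sqrt(1 - f^2) from that of f^2. *)
Lemma dist_sqrt_le (R : realType) (x y : R) : 0 <= x -> 0 <= y ->
  `|Num.sqrt x - Num.sqrt y| ^+ 2 <= `|x - y|.
Proof.
move=> x0 y0; rewrite -{2}(sqr_sqrtr x0) -{2}(sqr_sqrtr y0) subr_sqr normrM.
rewrite expr2 ler_wpM2l// (le_trans (ler_normB _ _))//.
by rewrite [leRHS]ger0_norm ?addr_ge0 ?sqrtr_ge0// !ger0_norm ?sqrtr_ge0.
Qed.

(** * The Cuntz relations and norm bounds in a covariant representation *)

Section BoundaryRepresentation.
Variables (R : realType).
Implicit Types (f h : cubeP -> R[i]) (p q : affN) (g k : affQ) (w : cubeP).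

Local Notation X := nica_boundary.
Local Notation ideal := (@pcp_ideal R affQ cubeP nica_boundary theta_dom).

Definition cylinder p : cubeP -> R[i] := fun w => (w p)%:R.

Lemma ideal_cont g f : ideal g f -> ideal 1%g f.
Proof.
move=> [fc _]; split=> // w wX []; rewrite /theta_dom /= !invg1.
exact/hull1/boundary_nica.
Qed.

Lemma eq_ideal g f h : (forall w, X w -> f w = h w) -> ideal g f -> ideal g h.
Proof.
move=> fh [fc f0]; split; last by move=> w wX wg; rewrite -fh// f0.
apply: subspace_eq_continuous fc => w; rewrite inE => wX; exact: fh.
Qed.

Lemma ideal_linear g (a : R[i]) f h : ideal g f -> ideal g h ->
  ideal g (fun w => a * f w + h w).
Proof.
move=> [fc f0] [hc h0]; split; last first.
  by move=> w wX wg; rewrite f0// h0// mulr0 addr0.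
move=> w; apply: (@continuousD _ R[i]^o); last exact: hc.
by apply: (@continuousM R[i]); [exact: cst_continuous|exact: fc].
Qed.

Lemma ideal_mul g f h : ideal 1%g f -> ideal g h ->
  ideal g (fun w => f w * h w).
Proof.
move=> [fc _] [hc h0]; split; last by move=> w wX wg; rewrite h0// mulr0.
by move=> w; apply: (@continuousM R[i]); [exact: fc|exact: hc].
Qed.

Lemma ideal_unif g f :
  (forall e : R, 0 < e -> exists c, forall w v,
     X w -> X v -> same_residue c w v -> cabs (f w - f v) <= e) ->
  (forall w, X w -> ~ hull w g -> f w = 0) -> ideal g f.
Proof.
move=> fu f0; split; first exact/boundary_continuousP.
by move=> w wX; rewrite /theta_dom /= invgK => wg; exact: f0.
Qed.

Lemma ideal_hull g f w : ideal g f -> X w -> ~ hull w g -> f w = 0.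
Proof. by move=> [_ f0] wX wg; apply: f0 => //; rewrite /theta_dom /= invgK. Qed.

Lemma ideal0 g : ideal g (fun=> 0).
Proof.
by apply: ideal_unif => // e e0; exists posnat1 => *; rewrite subrr cabs0 ltW.
Qed.

Lemma ideal1_cst (a : R[i]) : ideal 1%g (fun=> a).
Proof.
apply: ideal_unif => [e e0|w /boundary_nica wn []]; last exact: hull1.
by exists posnat1 => *; rewrite subrr cabs0 ltW.
Qed.

Lemma ideal_cylinder g p : (forall w, X w -> w p -> hull w g) ->
  ideal g (cylinder p).
Proof.
move=> pg; apply: ideal_unif => [e e0|w wX wg].
  exists p.2 => w v _ _ wv; rewrite /cylinder.
  have -> : w p = v p by have := wv p.1; case: (p).
  by rewrite subrr cabs0 ltW.
by rewrite /cylinder; have [/pg|] := boolP (w p) => // /(_ wX).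
Qed.

Lemma ideal_cylinder_emb p : ideal (affN_emb p) (cylinder p).
Proof. by apply: ideal_cylinder => w wX; rewrite hull_emb//; exact: boundary_nica. Qed.

Lemma ideal_cylinder1 p : ideal 1%g (cylinder p).
Proof. exact: ideal_cont (ideal_cylinder_emb p). Qed.

Lemma ideal_cylinder_quotient p q :
  ideal (affN_emb p * (affN_emb q)^-1)%g (cylinder p).
Proof.
apply: ideal_cylinder => w wX wp; exists p => //; exists q.
by rewrite invgM invgK -mulgA mulVg mulg1.
Qed.

Lemma ideal_embV p (a : R[i]) : ideal (affN_emb p)^-1%g (fun=> a).
Proof.
apply: ideal_unif => [e e0|w /boundary_nica wn []]; last exact: hull_embV.
by exists posnat1 => *; rewrite subrr cabs0 ltW.
Qed.

Lemma sum_cylinder (c : posnat) (P : pred 'I_(sval c)) (F : 'I_(sval c) -> R[i])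
    w (k : 'I_(sval c)) : X w -> w (val k, c) ->
  \sum_(j < sval c | P j) F j * cylinder (val j, c) w = if P k then F k else 0.
Proof.
move=> wX wk; have z j : j != k -> F j * cylinder (val j, c) w = 0.
  move=> jk; rewrite /cylinder; case: (boolP (w _)) => [wj|]; last by rewrite mulr0.
  have /residue_eq := nica_congruent (boundary_nica wX) wj wk.
  by rewrite !residue_id => -[/val_inj] E; rewrite E eqxx in jk.
case: ifPn => Pk.
  rewrite (bigD1 k)//= big1 ?addr0 => [|j /andP[_ jk]]; last exact: z.
  by rewrite /cylinder wk mulr1.
by rewrite big1// => j Pj; apply: z; apply: contraNneq Pk => <-.
Qed.

(** Particular to the boundary: in the whole spectrum the hereditary closure of (0, 1) contains (0,
    1) but not (1, 1). *)
Lemma cylinder_congr p (m : nat) (c : posnat) w : X w -> p.2 = c ->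
  ((sval c)%:Z %| p.1%:Z - m%:Z)%Z -> cylinder p w = cylinder (m, c) w.
Proof.
move=> wX pc pm; rewrite /cylinder; congr (_%:R).
have [j wj] := boundary_residue wX c.
case: p pc pm => [n a] /= -> nm; rewrite !wj; congr (nat_of_bool _).
apply/idP/idP => h; last exact: dvdz_sub_trans nm h.
by apply: dvdz_sub_trans h; rewrite dvdz_subC.
Qed.

Lemma boundary_ord (c : posnat) w : X w ->
  exists k : 'I_(sval c), w (val k, c) /\ same_residue c w (int_point (val k)%:Z).
Proof.
move=> wX; have [i wi] := boundary_residue wX c; have [k kE] := residue_ord i c.
exists k; split; first by rewrite wi -kE dvdz_residue.
move=> m; rewrite wi /int_point /= -kE; apply/idP/idP => mi.
  by apply: (dvdz_sub_trans mi); rewrite dvdz_subC dvdz_residue.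
by apply: (dvdz_sub_trans mi); rewrite dvdz_residue.
Qed.

Variables (B : cstarType R) (d : affQ -> (cubeP -> R[i]) -> B).
Hypothesis drep : pcp_rep X theta_dom theta d.

(** The image of the Toeplitz isometry w_p. *)
Definition cov p : B := d (affN_emb p) (cylinder p).

Lemma rep_ext g f h : (forall w, X w -> f w = h w) -> ideal g f -> d g f = d g h.
Proof. by move=> fh fg; apply: (pcp_ext drep) => //; exact: eq_ideal fh fg. Qed.

Lemma rep0 g : d g (fun=> 0) = 0.
Proof.
have := pcp_linear drep (-1) (ideal0 g) (ideal0 g); rewrite scaleN1r addNr => <-.
by congr d; apply/funext => w; rewrite mulr0 addr0.
Qed.

Lemma rep_sum g (I : Type) (r : seq I) (P : pred I) (a : I -> R[i])
    (F : I -> cubeP -> R[i]) : (forall i, P i -> ideal g (F i)) ->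
  ideal g (fun w => \sum_(i <- r | P i) a i * F i w) /\
  d g (fun w => \sum_(i <- r | P i) a i * F i w) =
    \sum_(i <- r | P i) a i *: d g (F i).
Proof.
move=> FI; elim: r => [|i r [IHi IHd]].
  have E : (fun w => \sum_(i <- [::] | P i) a i * F i w) = (fun=> 0).
    by apply/funext => w; rewrite big_nil.
  by rewrite E big_nil rep0; split=> //; exact: ideal0.
rewrite big_cons; case: ifPn => Pi; last first.
  have <- : (fun w => \sum_(j <- r | P j) a j * F j w) =
      (fun w => \sum_(j <- i :: r | P j) a j * F j w).
    by apply/funext => w; rewrite big_cons (negPf Pi).
  by [].
have E : (fun w => a i * F i w + \sum_(j <- r | P j) a j * F j w) =
    (fun w => \sum_(j <- i :: r | P j) a j * F j w).
  by apply/funext => w; rewrite big_cons Pi.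
rewrite -E -IHd; split; first exact: ideal_linear (FI _ Pi) IHi.
by rewrite (pcp_linear drep)//; exact: FI.
Qed.

Lemma rep1_mul g f h : ideal 1%g f -> ideal g h ->
  d 1%g f * d g h = d g (fun w => f w * h w).
Proof.
move=> f1 hg; rewrite (pcp_mul drep)// mul1g; apply/esym/rep_ext; last exact: ideal_mul.
move=> w /boundary_nica wn; rewrite /pcp_shift !invg1.
have w1 : w \in theta_dom 1%g by rewrite inE /theta_dom /= invg1; exact: hull1.
by rewrite !theta1// w1.
Qed.

Lemma in_dom_emb p w : nica_spectrum w -> w \in theta_dom (affN_emb p).
Proof. by move=> wn; rewrite inE; exact: hull_embV. Qed.

Lemma in_dom_embV p w : nica_spectrum w ->
  (w \in theta_dom (affN_emb p)^-1%g) = w p.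
Proof.
move=> wn; apply/idP/idP; rewrite inE /theta_dom /= invgK hull_emb//.
Qed.

Lemma cov_mul_rep p k h H : ideal k h -> ideal (affN_emb p * k)%g H ->
  (forall w, X w -> H w = if w p then h (theta (affN_emb p)^-1%g w) else 0) ->
  cov p * d k h = d (affN_emb p * k)%g H.
Proof.
move=> hk Hi HE; rewrite /cov (pcp_mul drep)//; last exact: ideal_cylinder_emb.
apply/esym/rep_ext => // w wX; have wn := boundary_nica wX.
rewrite HE// /pcp_shift in_dom_embV//; case: ifPn => // wp.
have vn := theta_embV_nica wn wp.
by rewrite invgK in_dom_emb// theta_embK// /cylinder wp mul1r.
Qed.

Lemma cov_star p : star (cov p) = d (affN_emb p)^-1%g (fun=> 1).
Proof.
rewrite (pcp_star drep); last exact: ideal_cylinder_emb.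
apply/esym/rep_ext; last exact: ideal_embV.
move=> w /boundary_nica wn; rewrite /pcp_shift invgK in_dom_emb//.
by rewrite /cylinder theta_emb_self// rmorph1.
Qed.

Lemma cov_mul p q : cov p * cov q = cov (affNM p q).
Proof.
rewrite {3}/cov affN_embM; apply: cov_mul_rep.
- exact: ideal_cylinder_emb.
- by rewrite -affN_embM; exact: ideal_cylinder_emb.
- move=> w /boundary_nica wn; rewrite /cylinder theta_embV//.
  case: (boolP (w p)) => // nwp; case: (boolP (w (affNM p q))) => // wpq.
  case/negP: nwp; have [_ wh _] := wn; apply: wh wpq.
  by apply/affN_leP; exists q.
Qed.

Lemma cov_mul_star p q :
  cov p * star (cov q) = d (affN_emb p * (affN_emb q)^-1)%g (cylinder p).
Proof.
rewrite cov_star; apply: cov_mul_rep.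
- exact: ideal_embV.
- exact: ideal_cylinder_quotient.
- by move=> w _; rewrite /cylinder; case: (w p).
Qed.

Lemma cov_range p : cov p * star (cov p) = d 1%g (cylinder p).
Proof. by rewrite cov_mul_star mulgV. Qed.

Lemma cov_isometry p : star (cov p) * cov p = 1.
Proof.
rewrite cov_star (pcp_mul drep); [|exact: ideal_embV|exact: ideal_cylinder_emb].
rewrite mulVg -(pcp_one drep); apply/esym/rep_ext; last exact: ideal1_cst.
move=> w /boundary_nica wn; rewrite /pcp_shift invgK in_dom_emb//.
rewrite /cylinder theta_emb_self// mulr1 ifT// inE /theta_dom /= invgK.
by exists p; [exact: theta_emb_self|exact: affQ_le_refl].
Qed.

Lemma cov_exp (n : nat) : cov (1%N, posnat1) ^+ n = cov (n, posnat1).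
Proof.
elim: n => [|n IHn].
  rewrite expr0 -(cov_isometry (0%N, posnat1)) cov_star.
  have -> : (affN_emb (0%N, posnat1))^-1%g = 1%g.
    by rewrite -invg1; congr (_^-1)%g; congr (_, _); apply: val_inj.
  by rewrite (pcp_one drep) mul1r.
rewrite exprS IHn cov_mul; congr cov; congr (_, _); last exact: posnat_eq.
by rewrite /= mul1n add1n.
Qed.

Lemma cov_split (n : nat) (a : posnat) :
  cov (n, a) = cov (1%N, posnat1) ^+ n * cov (0%N, a).
Proof.
rewrite cov_exp cov_mul; congr cov; congr (_, _).
  by rewrite /= muln0 addn0.
by apply: posnat_eq; rewrite /= mul1n.
Qed.

(** Two relations use the boundary: [s] is unitary because every boundary point contains (1, 1), and
    the range projections sum to 1 because the cylinders of level [a] partition the boundary. *)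
Lemma cov_QN : QN_relations (cov (1%N, posnat1)) (fun a => cov (0%N, a)).
Proof.
split.
- split; first exact: cov_isometry.
  rewrite cov_range -(pcp_one drep); apply: rep_ext; last exact: ideal_cylinder1.
  move=> w /boundary_residue /(_ posnat1)[k wk].
  by rewrite /cylinder wk dvdzE /= dvd1n.
- by move=> a; exact: cov_isometry.
- move=> a; rewrite -cov_split cov_mul; congr cov; congr (_, _).
    by rewrite /= muln1.
  by apply: posnat_eq; rewrite /= muln1.
- move=> a b; rewrite cov_mul; congr cov; congr (_, _).
  by rewrite /= muln0.
- move=> a; rewrite -(pcp_one drep).
  transitivity (\sum_(k < sval a) 1 *: d 1%g (cylinder (val k, a))).
    apply: eq_bigr => k _; rewrite scale1r -cov_range (cov_split (val k) a) starM star_exp.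
    by rewrite !mulrA.
  have [si <-] := @rep_sum 1%g _ (index_enum 'I_(sval a)) xpredT (fun=> 1)
    (fun k : 'I_(sval a) => cylinder (val k, a)) (fun _ _ => ideal_cylinder1 _).
  apply: rep_ext => // w wX; have [k [wk _]] := boundary_ord a wX.
  by rewrite (@sum_cylinder a xpredT (fun=> 1) w k).
Qed.

Lemma rep1_real_bound (f : cubeP -> R) (e : R) : 0 < e ->
  ideal 1%g (fun w => (f w)%:C%C) -> (forall w, X w -> `|f w| <= e) ->
  cnorm (d 1%g (fun w => (f w)%:C%C)) <= e.
Proof.
move=> e0 fi fe.
pose F w : R := f w / e; pose H w : R := Num.sqrt (1 - F w ^+ 2).
have F1 w : X w -> F w ^+ 2 <= 1.
  move=> wX; rewrite -real_normK ?num_real// expr_le1 ?normr_ge0//.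
  by rewrite normrM normfV (gtr0_norm e0) ler_pdivrMr// mul1r fe.
have i0 := ideal0 1%g.
have Fi : ideal 1%g (fun w => (F w)%:C%C).
  apply: eq_ideal (ideal_linear (e^-1)%:C%C fi i0) => w _.
  by rewrite addr0 -rmorphM mulrC.
have FFi := ideal_mul Fi Fi.
have Hi : ideal 1%g (fun w => (H w)%:C%C).
  apply: ideal_unif; last by move=> w /boundary_nica wn []; exact: hull1.
  move=> r r0; have r20 : 0 < r ^+ 2 by rewrite exprn_gt0.
  (* Tolerance r^2 for F^2 yields tolerance r for the square root. *)
  have [c cP] := (proj1 (boundary_continuousP _) (proj1 FFi)) _ r20.
  exists c => w v wX vX wv; rewrite -rmorphB cabs_real.
  rewrite -(@ler_pXn2r _ 2)// ?nnegrE ?normr_ge0 ?(ltW r0)//.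
  rewrite /H; apply: (le_trans (dist_sqrt_le _ _)); rewrite ?subr_ge0 ?F1//.
  have := cP _ _ wX vX wv; rewrite -!rmorphM -rmorphB cabs_real -!expr2.
  have -> : 1 - F w ^+ 2 - (1 - F v ^+ 2) = F v ^+ 2 - F w ^+ 2 by ring.
  by rewrite distrC.
have selfadj (h : cubeP -> R) : ideal 1%g (fun w => (h w)%:C%C) ->
    star (d 1%g (fun w => (h w)%:C%C)) = d 1%g (fun w => (h w)%:C%C).
  move=> hi; rewrite (pcp_star drep)// !invg1; apply/esym/rep_ext => //.
  move=> w /boundary_nica wn; rewrite /pcp_shift ifT.
    by rewrite invg1 theta1//; apply/esym/CrealP; rewrite complex_real.
  by rewrite inE /theta_dom /= !invg1; exact: hull1.
have -> : d 1%g (fun w => (f w)%:C%C) = e%:C%C *: d 1%g (fun w => (F w)%:C%C).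
  rewrite -[RHS]addr0 -(rep0 1%g) -(pcp_linear drep)//; apply: rep_ext => // w _.
  by rewrite addr0 -rmorphM mulrC divfK// gt_eqF.
rewrite cnormZr gtr0_norm// ler_piMr ?(ltW e0)//.
apply: (@cnorm_sum_squares _ _ _ (d 1%g (fun w => (H w)%:C%C))).
- exact: selfadj.
- exact: selfadj.
- by rewrite !rep1_mul//; congr d; apply/funext => w; rewrite mulrC.
- rewrite !rep1_mul// -[X in X + _]scale1r -(pcp_linear drep)//; last exact: ideal_mul.
  rewrite -(pcp_one drep); apply/esym/rep_ext; last exact: ideal1_cst.
  move=> w wX; rewrite mul1r -!rmorphM -rmorphD -!expr2 sqr_sqrtr ?subr_ge0 ?F1//.
  by rewrite subrKC.
Qed.

Lemma rep1_bound f (e : R) : 0 < e -> ideal 1%g f ->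
  (forall w, X w -> cabs (f w) <= e) -> cnorm (d 1%g f) <= 2 * e.
Proof.
move=> e0 fi fe.
have fu := proj1 (boundary_continuousP _) (proj1 fi).
have sub (h : R[i] -> R) : (forall x y, h (x - y) = h x - h y) ->
    (forall x, `|h x| <= cabs x) -> ideal 1%g (fun w => (h (f w))%:C%C).
  move=> hB hle; apply: ideal_unif => [r r0|w /boundary_nica wn []]; last exact: hull1.
  have [c cP] := fu _ r0; exists c => w v wX vX wv.
  by rewrite -rmorphB cabs_real -hB (le_trans (hle _))// cP.
have Rei : ideal 1%g (fun w => (complex.Re (f w))%:C%C).
  by apply: sub => [[? ?] [? ?]//|]; exact: Re_le_cabs.
have Imi : ideal 1%g (fun w => (complex.Im (f w))%:C%C).
  by apply: sub => [[? ?] [? ?]//|]; exact: Im_le_cabs.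
have -> : d 1%g f = 'i *: d 1%g (fun w => (complex.Im (f w))%:C%C) +
                    d 1%g (fun w => (complex.Re (f w))%:C%C).
  rewrite -(pcp_linear drep)//; apply: rep_ext => // w _.
  by rewrite addrC {1}[f _]complexE.
rewrite (le_trans (ler_cnormD _ _))// mulr_natl mulr2n lerD//.
  rewrite cnormZ normCi mul1r; apply: rep1_real_bound => // w wX.
  exact: le_trans (Im_le_cabs _) (fe _ wX).
apply: rep1_real_bound => // w wX; exact: le_trans (Re_le_cabs _) (fe _ wX).
Qed.

Definition affZ_range g (c : posnat) : pred 'I_(sval c) :=
  fun k : 'I_(sval c) => `[< exists i, affZ g i (val k)%:Z >].

(** A function in the ideal of [g] is supported on the cylinders met by the range of [g]. This
    splits it into a function at the identity and cylinders, for which [affZ_quotient] supplies a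
    formula in the isometries. *)
Lemma rep_range g f b c : affmod g b c -> ideal g f ->
  d g f = d 1%g f *
    \sum_(k < sval c | affZ_range g k) 1 *: d g (cylinder (val k, c)).
Proof.
move=> bc fg; have f1 := ideal_cont fg.
have cyl (k : 'I_(sval c)) : affZ_range g k -> ideal g (cylinder (val k, c)).
  move=> /asboolP[i ik]; have [p [q [gE p2 pk]]] := affZ_quotient bc ik.
  apply: (@eq_ideal _ (cylinder p)); last by rewrite gE; exact: ideal_cylinder_quotient.
  by move=> w wX; exact: cylinder_congr.
have [si <-] := @rep_sum g _ (index_enum 'I_(sval c)) (@affZ_range g c) (fun=> 1)
    (fun k : 'I_(sval c) => cylinder (val k, c)) cyl.
rewrite rep1_mul//; apply: rep_ext => // w wX.
have [k [wk _]] := boundary_ord c wX.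
rewrite (@sum_cylinder c _ (fun=> 1) w k)//; case: ifPn; rewrite ?mulr1// mulr0.
(* If [g] were in the hull, it would send some j to m with (m, a) in [w]; an upper bound of (m, a)
   and (k, c) would then carry the preimage along to k. *)
move=> nk; apply: (ideal_hull fg wX) => -[[m a] wm [[j b'] gE]].
move/negP: nk; apply; apply/asboolP.
have [_ _ wd] := boundary_nica wX.
have [z [_ /affN_le_res[_ /= mz] /affN_le_res[_ /= kz]]] := wd _ _ wm wk.
have E : affN_emb (m, a) = (g * affN_emb (j, b'))%g by rewrite -gE mulVKg.
have ja : affZ g j%:Z m%:Z by have := congr1 fst E; rewrite /affZ /= -!pmulrn.
have ba : affmod g b' a by have := congr1 (fun x => sval x.2) E.
move/dvdz_addP: mz => [t zE]; rewrite dvdz_subC in kz.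
move/dvdz_addP: kz => [t' kE].
exists (j%:Z + (sval b')%:Z * t + (sval b)%:Z * t').
by rewrite kE; apply: affZ_shift => //; rewrite zE; apply: affZ_shift.
Qed.

End BoundaryRepresentation.

(** At the identity, step functions are combinations of range projections and are uniformly dense;
    [rep_range] reduces the other group elements to products [cov p * star (cov q)]. *)
Lemma pcp_rep_unique (R : realType) (B : cstarType R)
    (d d' : affQ -> (cubeP -> R[i]) -> B) :
  pcp_rep nica_boundary theta_dom theta d ->
  pcp_rep nica_boundary theta_dom theta d' ->
  cov d (1%N, posnat1) = cov d' (1%N, posnat1) ->
  (forall a, cov d (0%N, a) = cov d' (0%N, a)) ->
  forall g f, pcp_ideal nica_boundary theta_dom g f -> d g f = d' g f.
Proof.
move=> rd rd' es eu.
have ecov p : cov d p = cov d' p.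
  by case: p => n a; rewrite (cov_split rd) (cov_split rd') es eu.
have equo p q : d (affN_emb p * (affN_emb q)^-1)%g (cylinder R p) =
    d' (affN_emb p * (affN_emb q)^-1)%g (cylinder R p).
  by rewrite -(cov_mul_star rd) -(cov_mul_star rd') !ecov.
have e1 f : pcp_ideal nica_boundary theta_dom 1%g f -> d 1%g f = d' 1%g f.
  move=> fi; apply/eqP; rewrite -subr_eq0; apply/eqP.
  apply: (@cnorm_eps_eq0 _ _ _ 4) => e e0.
  have [c cP] := (proj1 (boundary_continuousP _) (proj1 fi)) _ e0.
  (* The step function that samples [f] at the integers 0, ..., c - 1. *)
  pose fc w : R[i] := \sum_(k < sval c)
    f (int_point (val k)%:Z) * cylinder R (val k, c) w.
  have [fci fcd] := @rep_sum _ _ _ rd 1%g _ (index_enum 'I_(sval c)) xpredT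
    (fun k : 'I_(sval c) => f (int_point (val k)%:Z)) (fun k => cylinder R (val k, c))
    (fun _ _ => ideal_cylinder1 R _).
  have [_ fcd'] := @rep_sum _ _ _ rd' 1%g _ (index_enum 'I_(sval c)) xpredT
    (fun k : 'I_(sval c) => f (int_point (val k)%:Z)) (fun k => cylinder R (val k, c))
    (fun _ _ => ideal_cylinder1 R _).
  have fcE : d 1%g fc = d' 1%g fc.
    rewrite fcd fcd'; apply: eq_bigr => k _; congr (_ *: _).
    by rewrite -(cov_range rd) -(cov_range rd') ecov.
  have gi := ideal_linear (-1) fci fi.
  have close w : nica_boundary w -> cabs (-1 * fc w + f w) <= e.
    move=> wX; have [k [wk wres]] := boundary_ord c wX.
    rewrite /fc (@sum_cylinder _ c xpredT (fun k : 'I_(sval c) => f (int_point (val k)%:Z)) w k)//.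
    by rewrite mulN1r addrC; apply: cP => //; exact: int_point_boundary.
  have -> : d 1%g f - d' 1%g f =
      d 1%g (fun w => -1 * fc w + f w) - d' 1%g (fun w => -1 * fc w + f w).
    rewrite (pcp_linear rd)// (pcp_linear rd')// fcE.
    by rewrite opprD addrACA subrr add0r.
  apply: (le_trans (ler_cnormB _ _)).
  have -> : 4 * e = 2 * e + 2 * e by ring.
  by apply: lerD; [exact: (rep1_bound rd)|exact: (rep1_bound rd')].
move=> g f fg; have [b [c [bc _]]] := affmod_min g.
rewrite (rep_range rd bc fg) (rep_range rd' bc fg) e1; last exact: ideal_cont fg.
congr (_ * _); apply: eq_bigr => k /asboolP[i ik]; congr (_ *: _).
have [p [q [gE p2 pk]]] := affZ_quotient bc ik.
have pX w : nica_boundary w -> cylinder R p w = cylinder R (val k, c) w.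
  by move=> wX; exact: cylinder_congr.
rewrite -(rep_ext rd pX) ?gE; last exact: ideal_cylinder_quotient.
rewrite equo; apply: (rep_ext rd' pX); exact: ideal_cylinder_quotient.
Qed.

(** * The representation of the boundary crossed product in Q_N *)

Section IntegerPoints.
Implicit Types (g : affQ) (i j : int).

Lemma hull_affZ g (w : cubeP) : hull w g -> exists i m (b a : posnat),
  [/\ affmod g b a, affZ g i m%:Z & w (m, a)].
Proof.
move=> [[m a] wm [[n b] gE]]; exists n%:Z, m, b, a.
have E : affN_emb (m, a) = (g * affN_emb (n, b))%g by rewrite -gE mulVKg.
split=> //; first exact: (congr1 (fun x => sval x.2) E).
by have := congr1 fst E; rewrite /affZ /= -!pmulrn.
Qed.

(** Translates the partial action on the boundary, along the dense set of integers, into the partial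
    action on Z. *)
Lemma hull_int_point g j : hull (int_point j) g <-> exists i, affZ g i j.
Proof.
split=> [/hull_affZ[i [m [b [a [ba im]]]]]|[i ij]].
  rewrite /int_point /= dvdz_subC => /dvdz_addP[t ->].
  by exists (i + (sval b)%:Z * t); exact: affZ_shift.
have [b [c [bc _]]] := affmod_min g.
have [p [q [-> pc pj]]] := affZ_quotient bc ij.
exists p; first by rewrite /int_point pc.
by exists q; rewrite invgM invgK -mulgA mulVg mulg1.
Qed.

Lemma theta_int_point g i j :
  affZ g i j -> theta g (int_point i) = int_point j.
Proof.
move=> ij; apply/funext => q.
have embE : (exists l, affZ (affN_emb q) l j) <-> int_point j q.
  rewrite /int_point dvdz_subC; split=> [[l lj]|/dvdz_addP[l ->]].
    apply/dvdz_addP; exists l; apply: (affZ_fun lj).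
    by rewrite /affZ /= intrD intrM.
  by exists l; rewrite /affZ /= intrD intrM.
apply/idP/idP => [/thetaP/hull_int_point[l li]|/embE[l lj]].
  by apply/embE; exists l; have := affZM li ij; rewrite mulVKg.
apply/thetaP/hull_int_point; exists l; exact: affZM lj (affZV ij).
Qed.

Lemma transport_shift (R : realType) g (f : cubeP -> R[i]) :
  transport g (fun i => f (int_point i))
    (fun j => pcp_shift theta_dom theta g f (int_point j)).
Proof.
split=> [i j ij|j nij]; rewrite /pcp_shift.
  rewrite ifT ?(theta_int_point (affZV ij))//.
  by rewrite inE /theta_dom /= invgK hull_int_point; exists i.
case: ifPn => //; rewrite inE /theta_dom /= invgK hull_int_point.
by move=> [i /nij].
Qed.

Lemma ideal_int_point (R : realType) g (f : cubeP -> R[i]) :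
  pcp_ideal nica_boundary theta_dom g f ->
  profinite_continuous (fun i => f (int_point i)) /\
  forall j, (forall i, ~ affZ g i j) -> f (int_point j) = 0.
Proof.
move=> fg; split=> [e e0|j nij]; last first.
  apply: (ideal_hull fg); first exact: int_point_boundary.
  by move=> /hull_int_point[i /nij].
have [c cP] := proj1 (boundary_continuousP _) (proj1 fg) _ e0.
exists c => i j ij; apply: cP; [exact: int_point_boundary..|] => m.
rewrite /int_point /=; apply/idP/idP => mi; first exact: dvdz_sub_trans mi ij.
by apply: (dvdz_sub_trans mi); rewrite dvdz_subC.
Qed.

End IntegerPoints.

Section ProfiniteContinuity.
Variable R : realType.
Implicit Types (f h : int -> R[i]).

Lemma profinite_bounded f : profinite_continuous f ->
  exists2 M : R, 0 < M & forall i, cabs (f i) <= M.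
Proof.
move=> /(_ 1 ltr01)[c cP]; pose M := \sum_(k < sval c) cabs (f k%:Z).
have M0 : 0 <= M by apply: sumr_ge0 => k _; exact: cabs_ge0.
exists (1 + M); first by rewrite ltr_pwDl.
move=> i; rewrite -(subrK (f (residue i c)) (f i)).
apply: (le_trans (cabsD _ _)); apply: lerD.
  by apply: cP; rewrite dvdz_subC dvdz_residue.
have [k ->] := residue_ord i c; rewrite /M (bigD1 k)//= lerDl.
by apply: sumr_ge0 => l _; exact: cabs_ge0.
Qed.

Lemma profinite_mul f h : profinite_continuous f -> profinite_continuous h ->
  profinite_continuous (fun i => f i * h i).
Proof.
move=> fc hc e e0.
have [M M0 fM] := profinite_bounded fc; have [N N0 hN] := profinite_bounded hc.
have [b bP] := fc _ (divr_gt0 (divr_gt0 e0 (ltr0n _ 2)) N0).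
have [c cP] := hc _ (divr_gt0 (divr_gt0 e0 (ltr0n _ 2)) M0).
exists (posnatM b c) => i j ij.
have bij : ((sval b)%:Z %| i - j)%Z.
  by apply: dvdz_trans ij; rewrite /= PoszM dvdz_mulr.
have cij : ((sval c)%:Z %| i - j)%Z.
  by apply: dvdz_trans ij; rewrite /= PoszM dvdz_mull.
have -> : f i * h i - f j * h j = (f i - f j) * h i + f j * (h i - h j) by ring.
apply: (le_trans (cabsD _ _)); rewrite !cabsM.
have -> : e = e / 2 / N * N + M * (e / 2 / M).
  by field; rewrite !gt_eqF.
by apply: lerD; apply: ler_pM; rewrite ?cabs_ge0// ?bP ?cP.
Qed.

Lemma profinite_conj f : profinite_continuous f ->
  profinite_continuous (fun i => (f i)^*).
Proof.
move=> fc e /fc[c cP]; exists c => i j /cP.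
by rewrite -rmorphB cabs_conj.
Qed.

(** With [b] and [c] the minimal moduli of [g], two integers congruent modulo c n are both in the
    range of [g] or both outside; in the first case their preimages are congruent modulo b n. *)
Lemma profinite_transport g f h : profinite_continuous f -> transport g f h ->
  profinite_continuous h.
Proof.
move=> fc [hE h0] e e0; have [n nP] := fc _ e0.
have [b [c [bc _]]] := affmod_min g.
have bcn := affmodMr n bc.
exists (posnatM c n) => i j; rewrite dvdz_subC => /dvdz_addP[q jE].
have [[i0 ii0]|ni] := pselect (exists i0, affZ g i0 i).
  have jj0 := affZ_shift q bcn ii0; rewrite -jE in jj0.
  rewrite (hE _ _ ii0) (hE _ _ jj0); apply: nP.
  by rewrite dvdz_subC addrC addKr /= PoszM -mulrA dvdz_mull// dvdz_mulr.
rewrite h0 => [|i0 ii0]; last by apply: ni; exists i0.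
rewrite h0 ?subrr ?cabs0 ?ltW// => j0 jj0; apply: ni.
have := affZ_shift (- q) bcn jj0; rewrite jE !mulrN addrK.
by exists (j0 - (sval (posnatM b n))%:Z * q).
Qed.

End ProfiniteContinuity.

Section QNRepresentation.
Variables (R : realType) (Q : cstarType R) (s : Q) (u : posnat -> Q).
Hypothesis rel : QN_relations s u.

(** Made total by the value 0 in the absence of a limit, since a representation is a map on all
    functions. *)
Definition diag_value (f : int -> R[i]) : Q := xget 0 [set x | diag_lim s u f x].

Lemma diag_valueP f : profinite_continuous f -> diag_lim s u f (diag_value f).
Proof. by move=> fc; exact: (xgetPex 0 (diag_lim_exists rel fc)). Qed.

Lemma diag_valueE f x : diag_lim s u f x -> diag_value f = x.
Proof.
move=> fx; apply: diag_lim_unique (fx).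
exact: (xgetPex 0 (ex_intro _ x fx)).
Qed.

Definition qrep (g : affQ) (f : cubeP -> R[i]) : Q :=
  diag_value (fun i => f (int_point i)) * piso rel g.

Lemma qrep_pcp : pcp_rep nica_boundary theta_dom theta qrep.
Proof.
split.
- move=> g f h _ _ fh; rewrite /qrep; congr (diag_value _ * _); apply/funext => i.
  by rewrite fh//; exact: int_point_boundary.
- move=> g a f h /ideal_int_point[fc _] /ideal_int_point[hc _].
  rewrite /qrep (diag_valueE (diag_lim_linear a (diag_valueP fc) (diag_valueP hc))).
  by rewrite mulrDl scalerAl.
(* With V for [piso]: f V_g h V_k = V_g F h V_k = T V_g V_k = T V_g V_(g^-1) V_(g k) = T V_(g k),
   where T is F h transported by g. *)
- move=> g k f h /ideal_int_point[fc f0] /ideal_int_point[hc _]; rewrite /qrep.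
  set F := pcp_shift _ _ g^-1%g f.
  have tF := transport_shift g^-1%g f; rewrite -/F in tF.
  have Fc := profinite_transport fc tF.
  have tf : transport g (fun i => F (int_point i)) (fun i => f (int_point i)).
    by split=> // i j /affZV ij; rewrite (proj1 tF _ _ ij).
  have Fhc := profinite_mul Fc hc.
  have tT := transport_shift g (fun w => F w * h w).
  have Tc := profinite_transport Fhc tT.
  rewrite mulrA -(piso_diag rel Fc (diag_valueP Fc) (diag_valueP fc) tf) -(mulrA (piso _ _)).
  have lim := diag_lim_mul rel (diag_valueP Fc) (diag_valueP hc).
  rewrite (piso_diag rel Fhc lim (diag_valueP Tc) tT) -mulrA piso_mul mulrA.
  by rewrite (diag_piso_range rel (diag_valueP Tc) (proj2 tT)).
- move=> g f /ideal_int_point[fc _]; rewrite /qrep starM piso_star.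
  have tf := transport_shift g^-1%g (fun w => (f w)^*).
  have cfc := profinite_conj fc.
  have lim := diag_lim_star (diag_valueP fc).
  have tc := profinite_transport cfc tf.
  exact: (piso_diag rel cfc lim (diag_valueP tc) tf).
- by rewrite /qrep piso1 mulr1; apply: diag_valueE; exact: diag_lim1.
Qed.

(** On the integers [cylinder p] is the constant 1 transported by [p], so covariance absorbs it into
    the isometry. *)
Lemma qrep_cov p : cov qrep p = wiso s u p.1%:Z p.2.
Proof.
rewrite /cov /qrep.
have [fc f0] := ideal_int_point (ideal_cylinder_emb R p).
have tp : transport (affN_emb p) (fun=> 1)
    (fun j => cylinder R p (int_point j)).
  split=> // i j ij; rewrite /cylinder (_ : int_point j p)//.
  apply/(hull_emb _ (int_point_nica j))/hull_int_point.
  by exists i.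
have c1 : profinite_continuous (fun _ : int => 1 : R[i]).
  by move=> e e0; exists posnat1 => i j _; rewrite subrr cabs0 ltW.
rewrite -(piso_diag rel c1 (diag_lim1 rel) (diag_valueP fc) tp) mulr1.
exact: piso_emb.
Qed.

End QNRepresentation.

(** * Composition with homomorphisms and restriction to a subspace *)

Section StarHom.
Variable R : realType.
Implicit Types A B C : cstarType R.

Lemma star_hom_id A : star_hom (fun x : A => x).
Proof. by split. Qed.

Lemma star_hom_comp A B C (phi : A -> B) (psi : B -> C) :
  star_hom phi -> star_hom psi -> star_hom (psi \o phi).
Proof.
move=> [l1 o1 m1 s1] [l2 o2 m2 s2]; split=> /=.
- by move=> a x y /=; rewrite l1 l2.
- by rewrite o1 o2.
- by move=> x y /=; rewrite m1 m2.
- by move=> x /=; rewrite s1 s2.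
Qed.

Lemma pcp_rep_comp (G : groupType) (T : topologicalType) (X : set T)
    (dom : G -> set T) act A B (d : G -> (T -> R[i]) -> A) (phi : A -> B) :
  star_hom phi -> pcp_rep X dom act d ->
  pcp_rep X dom act (fun g f => phi (d g f)).
Proof.
move=> [pl p1 pm ps] [de dl dm ds d1]; split.
- by move=> g f h fg hg fh; rewrite (de g f h).
- by move=> g a f h fg hg; rewrite dl// pl.
- by move=> g k f h fg hk; rewrite -pm dm.
- by move=> g f fg; rewrite -ps ds.
- by rewrite d1.
Qed.

Lemma pcp_ideal_sub (G : groupType) (T : topologicalType) (X Y : set T)
    (dom : G -> set T) g (f : T -> R[i]) :
  Y `<=` X -> pcp_ideal X dom g f -> pcp_ideal Y dom g f.
Proof.
move=> YX [fc f0]; split; first exact: continuous_subspaceW YX fc.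
by move=> x /YX; exact: f0.
Qed.

(** Functions are total on the ambient space, so restriction leaves the function unchanged and only
    weakens what is asked of it. This is the source of the quotient map [rho]. *)
Lemma pcp_rep_sub (G : groupType) (T : topologicalType) (X Y : set T)
    (dom : G -> set T) act B (d : G -> (T -> R[i]) -> B) :
  Y `<=` X -> pcp_rep Y dom act d -> pcp_rep X dom act d.
Proof.
move=> YX [de dl dm ds d1]; split=> //.
- move=> g f h fg hg fh; apply: de; [exact: pcp_ideal_sub fg|exact: pcp_ideal_sub hg|].
  by move=> x /YX; exact: fh.
- by move=> g a f h fg hg; apply: dl; [exact: pcp_ideal_sub fg|exact: pcp_ideal_sub hg].
- by move=> g k f h fg hg; apply: dm; [exact: pcp_ideal_sub fg|exact: pcp_ideal_sub hg].
- by move=> g f fg; apply: ds; exact: pcp_ideal_sub fg.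
Qed.

End StarHom.

Lemma nica_ideal_indicator (R : realType) (p : affN) :
  pcp_ideal nica_spectrum theta_dom (affN_emb p)
    (\1_(theta (affN_emb p) @` nica_spectrum) : cubeP -> R[i]).
Proof.
have E w : nica_spectrum w ->
    cylinder R p w = \1_(theta (affN_emb p) @` nica_spectrum) w.
  move=> wn; rewrite /cylinder indicE; congr (nat_of_bool _)%:R.
  by apply/idP/idP; rewrite inE => /(theta_emb_image p wn).
split; last first.
  move=> w wn; rewrite -E// /theta_dom /= invgK hull_emb// /cylinder.
  by case: (w p).
apply: (@subspace_eq_continuous _ _ _ (cylinder R p : cubeP -> R[i]^o)).
  by move=> w; rewrite inE; exact: E.
apply: continuous_subspaceT => w A wA.
apply: filterS (nbhs_cylinder w [:: p]) => v /=; rewrite andbT => /eqP vw.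
by rewrite /cylinder vw; exact: nbhs_singleton wA.
Qed.

Theorem theorem6p3 (R : realType)
    (* Q_N *)
    (Q : cstarType R) (s : Q) (u : posnat -> Q) (hQ : is_QN s u)
    (* the Toeplitz algebra of N ><| N^x *)
    (T : cstarType R) (w : affN -> T) (hT : is_toeplitz_algebra w)
    (* C(Omega) ><| G *)
    (E : cstarType R) (dE : affQ -> (cubeP -> R[i]) -> E)
    (hE : is_partial_crossed_product nica_spectrum theta_dom theta dE)
    (* the canonical isomorphism from the Toeplitz algebra to C(Omega) ><| G *)
    (kappa : T -> E) (hkappa : star_iso kappa)
    (hkappaw : forall x : affN, kappa (w x) =
       dE (affN_emb x) (\1_(theta (affN_emb x) @` nica_spectrum)))
    (* C(dOmega) ><| G *)
    (B : cstarType R) (dB : affQ -> (cubeP -> R[i]) -> B)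
    (hB : is_partial_crossed_product nica_boundary theta_dom theta dB) :
  (* the quotient map E -> B induced by restriction of functions *)
  exists rho : E -> B,
    [/\ star_hom rho,
        forall (g : affQ) (f : cubeP -> R[i]),
          pcp_ideal nica_spectrum theta_dom g f -> rho (dE g f) = dB g f &
        exists! phi : Q -> B,
          [/\ star_iso phi,
              phi s = rho (kappa (w (1%N, posnat1))) &
              forall a : posnat, phi (u a) = rho (kappa (w (0%N, a)))]].
Proof.
pose X := nica_boundary.
have XO : X `<=` nica_spectrum by move=> v; exact: boundary_nica.
have [repB _ univB] := hB; have [_ _ univE] := hE; have [relQ _ univQ] := hQ.
have [rho [[rho_hom rhoE] _]] := univE _ _ (pcp_rep_sub XO repB).
have rho_w p : rho (kappa (w p)) = cov dB p.
  rewrite hkappaw rhoE; last exact: nica_ideal_indicator.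
  apply/esym/(rep_ext repB); last exact: ideal_cylinder_emb.
  move=> v /boundary_nica vn; rewrite /cylinder indicE; congr (nat_of_bool _)%:R.
  by apply/idP/idP; rewrite inE => /(theta_emb_image p vn).
exists rho; split=> //.
have [phi [[phi_hom phis phiu] phi_uniq]] := univQ _ _ _ (cov_QN repB).
have [psi [[psi_hom psiE] _]] := univB _ _ (qrep_pcp relQ).
have psi_cov p : psi (cov dB p) = wiso s u p.1%:Z p.2.
  by rewrite psiE; [exact: qrep_cov|exact: ideal_cylinder_emb].
have psis : psi (phi s) = s.
  by rewrite phis psi_cov wisoE /= expr1 (QN_u1 relQ) mulr1.
have psiu a : psi (phi (u a)) = u a.
  by rewrite phiu psi_cov wisoE /= expr0 mul1r.
(* The composite fixes the generators, so uniqueness in the universal property of Q_N identifies it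
   with the identity. *)
have psiK : cancel phi psi.
  have [i [_ i_uniq]] := univQ _ _ _ relQ.
  have e1 : i = (fun x => x) by apply: i_uniq; split=> //; exact: star_hom_id.
  have e2 : i = psi \o phi.
    by apply: i_uniq; split=> //; exact: star_hom_comp.
  by move=> x; rewrite -[LHS]/((psi \o phi) x) -e2 e1.
(* Here [pcp_rep_unique] extends agreement on the isometries to every [dB g f], after which
   uniqueness in the universal property of [B] applies. *)
have phiK : cancel psi phi.
  have hom := star_hom_comp psi_hom phi_hom.
  have phipsi := pcp_rep_unique (pcp_rep_comp hom repB) repB.
  have [i [_ i_uniq]] := univB _ _ repB.
  have e1 : i = (fun x => x) by apply: i_uniq; split=> //; exact: star_hom_id.
  have e2 : i = phi \o psi.
    apply: i_uniq; split=> // g f fg; apply: phipsi => // [|a]; rewrite /cov /=.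
      by rewrite -/(cov dB _) -phis psis.
    by rewrite -/(cov dB _) -phiu psiu.
  by move=> x; rewrite -[LHS]/((phi \o psi) x) -e2 e1.
exists phi; split.
  split; first by split=> //; exists psi.
    by rewrite rho_w.
  by move=> a; rewrite rho_w.
move=> phi' [[phi'_hom _] phi's phi'u]; apply: phi_uniq; split=> //.
  by rewrite phi's rho_w.
by move=> a; rewrite phi'u rho_w.
Qed.
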